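(* Let $X$ be a smooth projective split toric variety over $\mathbb{Q}$ with $-K_X$ globally generated, $r=\operatorname{rank}\operatorname{Pic}(X)$, with canonical model $\mathcal{X}$. Let $Z\subset X$ be Zariski closed of codimension at least two and $\mathcal{Z}$ its Zariski closure in $\mathcal{X}$. Then uniformly for every $N>1$, $$\#\{P\in T_O(\mathbb{Q}):H_{\mathrm{tor}}(P)\le B,\ \exists\,p\ge N\text{ prime with }\widetilde P\bmod p\in\mathcal{Z}(\mathbb{F}_p)\}\ll_Z\frac{B(\log B)^{r-1}}{N\log N}+B(\log B)^{r-2}\log\log B.$$
   Context: $X$ is given by a complete regular fan $\Delta$, $T_O$ is the open torus orbit, $\mathcal{X}=\mathrm{Tor}_\mathbb{Z}(\Delta)$ is the canonical smooth projective $\mathbb{Z}$-model, and for $P\in X(\mathbb{Q})$, $\widetilde P\in\mathcal{X}(\mathbb{Z})$ is its unique lift. $H_{\mathrm{tor}}(P)=H_{\mathcal{O}(1)}(i(P))$, where $i:X\to\mathbb{P}^K$ is given by the basis of torus characters of $H^0(X,-K_X)$ and $H_{\mathcal{O}(1)}([x_0:\dots:x_K])=\max|x_i|$ for coprime integer coordinates. *)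

(* Defs.v *)
From HB Require Import structures.
From mathcomp Require Import all_boot all_order all_algebra algC.
From mathcomp Require Import mpoly.
From mathcomp Require Import reals exp.

Set Implicit Arguments.
Unset Strict Implicit.
Unset Printing Implicit Defensive.

Import Order.TTheory GRing.Theory Num.Theory.
Local Open Scope ring_scope.

Section Toric.
(* A fan in N = Z^n with k rays; ray generator of the ray rho is v rho,
   a vector of Z^n (v rho i = its i-th coordinate).  [cones] lists the
   maximal cones, each given by the set of rays generating it. *)
Variables (n k : nat) (v : 'I_k -> 'I_n -> int) (cones : seq {set 'I_k}).

Definition pairing (m : 'I_n -> int) (rho : 'I_k) : int :=
  \sum_(i < n) m i * v rho i.

Definition in_cone (s : {set 'I_k}) (w : 'I_n -> rat) : Prop :=
  exists c : 'I_k -> rat, (forall rho, 0 <= c rho) /\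
    forall i, w i = \sum_(rho in s) c rho * (v rho i)%:~R.

Definition regular_cone (s : {set 'I_k}) : Prop :=
  #|s| = n /\ forall w : 'I_n -> int, exists c : 'I_k -> int,
    forall i, w i = \sum_(rho in s) c rho * v rho i.

Definition complete_regular_fan : Prop :=
  [/\ forall s, s \in cones -> regular_cone s,
      forall rho, exists2 s, s \in cones & rho \in s,
      forall s t, s \in cones -> t \in cones -> forall w,
        in_cone s w -> in_cone t w -> in_cone (s :&: t) w
    & forall w, exists2 s, s \in cones & in_cone s w].

(* the toric variety is projective: some T-Cartier divisor
   D = sum_rho (- a rho) D_rho has a strictly convex support function
   (ampleness criterion) *)
Definition projective_fan : Prop :=
  exists a : 'I_k -> int, forall s, s \in cones ->
    exists m : 'I_n -> int,
      (forall rho, rho \in s -> pairing m rho = a rho) /\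
      (forall rho, rho \notin s -> a rho < pairing m rho).

(* -K_X = sum_rho D_rho is globally generated (basepoint-free criterion:
   each m_sigma lies in the polytope P_{-K}) *)
Definition anticanonical_gg : Prop :=
  forall s, s \in cones -> exists m : 'I_n -> int,
    (forall rho, rho \in s -> pairing m rho = -1) /\
    (forall rho, -1 <= pairing m rho).

(* lattice points of the anticanonical polytope = torus characters
   forming a basis of H^0(X, -K_X) *)
Definition in_antican_polytope (m : 'I_n -> int) : Prop :=
  forall rho, -1 <= pairing m rho.

Definition in_torus (t : 'rV[rat]_n) : Prop := forall i, t 0 i != 0.

Definition chi (m : 'I_n -> int) (t : 'rV[rat]_n) : rat :=
  \prod_(i < n) t 0 i ^ m i.

(* H_tor(t) <= B : the point i(t) = [chi^m(t)]_m of P^K has a representative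
   lambda * (chi^m(t))_m (lambda > 0) by coprime integers, and the maximum of
   their absolute values is <= B. *)
Definition Htor_le (R : realType) (t : 'rV[rat]_n) (B : R) : Prop :=
  exists lambda : rat, 0 < lambda /\
    (forall m, in_antican_polytope m ->
       exists z : int, lambda * chi m t = z%:~R) /\
    (forall p, prime p -> exists m, in_antican_polytope m /\
       exists z : int, lambda * chi m t = z%:~R /\ ~~ (p %| `|z|)%N) /\
    (forall m, in_antican_polytope m -> ratr `|lambda * chi m t| <= B).

(* x is outside the exceptional (irrelevant) locus V(B) *)
Definition cox_nonsing (K : nzRingType) (x : 'I_k -> K) : Prop :=
  exists2 s, s \in cones & forall rho, rho \notin s -> x rho != 0.

(* x in Z^k is integral Cox coordinates of the unique lift in X(Z) of the
   torus point t: chi^{e_i}(t) = prod_rho x_rho^{<e_i, v_rho>} and for every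
   prime p, x mod p is outside V(B) (i.e. x defines a point of the canonical
   model over Z) *)
Definition cox_lift (t : 'rV[rat]_n) (x : 'I_k -> int) : Prop :=
  [/\ forall rho, x rho != 0,
      forall i, t 0 i = \prod_(rho < k) ((x rho)%:~R : rat) ^ v rho i
    & forall p, prime p -> exists2 s, s \in cones &
        forall rho, rho \notin s -> ~~ (p %| `|x rho|)%N].

(* Z is given by finitely many Pic(X)-homogeneous polynomials F in the Cox
   ring Q[x_rho : rho] : Z = (V(F) \ V(B)) / G. *)
Definition cox_homogeneous (f : mpoly.mpoly k rat) : Prop :=
  forall a b : mpoly.multinom k,
    a \in mpoly.msupp f -> b \in mpoly.msupp f ->
    exists m : 'I_n -> int, forall rho,
      (mpoly.fun_of_multinom a rho)%:Z - (mpoly.fun_of_multinom b rho)%:Z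
      = pairing m rho.

Definition in_cone_over_Z (F : seq (mpoly.mpoly k rat)) (x : 'I_k -> algC)
  : Prop :=
  cox_nonsing x /\
  forall f, f \in F -> mpoly.meval x (mpoly.map_mpoly (fun q : rat => ratr q) f) = 0.

Definition is_ideal (I : mpoly.mpoly k rat -> Prop) : Prop :=
  [/\ I 0, forall f g, I f -> I g -> I (f + g) & forall f g, I g -> I (f * g)].

Definition is_prime_ideal (I : mpoly.mpoly k rat -> Prop) : Prop :=
  [/\ is_ideal I, ~ I 1 & forall f g, I (f * g) -> I f \/ I g].

Definition cox_monomial_compl (s : {set 'I_k}) : mpoly.mpoly k rat :=
  \prod_(rho < k | rho \notin s) @mpoly.mpolyX k rat (mpoly.mX rho).

(* dim (V(F) \ V(B)) >= d : on some chart D(x^{hat sigma}) there is a chain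
   P_0 < P_1 < ... < P_d of prime ideals containing F and avoiding
   x^{hat sigma} (Krull dimension of Q[x]_{x^hat sigma}/(F)). *)
Definition cone_dim_ge (F : seq (mpoly.mpoly k rat)) (d : nat) : Prop :=
  exists2 s, s \in cones &
    exists P : nat -> (mpoly.mpoly k rat -> Prop),
      [/\ forall j, (j <= d)%N -> is_prime_ideal (P j),
          forall f, f \in F -> P 0%N f,
          forall j, (j < d)%N ->
            (forall f, P j f -> P j.+1 f) /\ exists f, P j.+1 f /\ ~ P j f
        & ~ P d (cox_monomial_compl s)].

(* Z has codimension >= 2 in X: dim Z <= n - 2, i.e. the affine cone
   V(F) \ V(B) (a G-torsor over Z, dim G = r = k - n) has dim <= k - 2. *)
Definition codim_ge2 (F : seq (mpoly.mpoly k rat)) : Prop :=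
  ~ cone_dim_ge F (k.-1).

(* the ideal (in Z[x_rho]) of the Zariski closure of Z in the canonical
   model: integer polynomials vanishing on the cone over Z *)
Definition in_closure_ideal (F : seq (mpoly.mpoly k rat))
  (f : mpoly.mpoly k int) : Prop :=
  forall x : 'I_k -> algC, in_cone_over_Z F x ->
    mpoly.meval x (mpoly.map_mpoly (fun z : int => z%:~R) f) = 0.

Definition reduction_in_Z (F : seq (mpoly.mpoly k rat)) (x : 'I_k -> int)
  (p : nat) : Prop :=
  forall f, in_closure_ideal F f -> (p%:Z %| mpoly.meval x f)%Z.

Definition bad_point (R : realType) (F : seq (mpoly.mpoly k rat))
  (N B : R) (t : 'rV[rat]_n) : Prop :=
  [/\ in_torus t, Htor_le t B &
      exists x, cox_lift t x /\
        exists p, [/\ prime p, N <= p%:R & reduction_in_Z F x p]].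

End Toric.

(* Main.v *)
(* The Cox coordinates x of a torus point of height at most B are sorted by their dyadic sizes
   2^(a_rho) into boxes of volume 2^(sum a). Choosing the cone of the fan that contains
   - sum_rho a_rho v_rho, the volumes of all boxes add up to O(B (log B)^(r-1)), and those with a
   given coordinate of given small size to O(B (log B)^(r-2)); the O(log log B) sizes at most
   (log B)^2 give the second term of the bound.
   On the remaining boxes all sides exceed M = (log B)^2 and Ekedahl's sieve applies. Codimension at
   least two provides, for every variable, a nonzero polynomial in the ideal of Z free of that
   variable. Eliminating one variable after another, a prime p <= M divides all of them on a
   proportion O(1/p^2) of the box, and some prime p > M does so on a proportion O(log B / M).
   Finally sum_(p >= N) 1/p^2 = O(1/(N log N)) by Chebyshev's bound. *)

Require Import Defs.
From HB Require Import structures.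
From mathcomp Require Import all_boot all_order all_algebra algC.
From mathcomp Require Import mpoly.
From mathcomp Require Import boolp reals sequences exp.
From mathcomp Require Import ring lra zify.

Set Implicit Arguments.
Unset Strict Implicit.
Unset Printing Implicit Defensive.

Import Order.TTheory GRing.Theory Num.Theory.
Local Open Scope ring_scope.

(** * Evaluation of multivariate polynomials *)

(** On a cone the exponents a are exchanged for the height exponent h, the n cone coordinates c_i of
    - sum_rho a_rho v_rho and r - 1 of the a_rho, with sum a = h - sum c_i. Summing 2^(sum a) is
    geometric in h and in the c_i, so only the r - 1 free exponents, each O(log B), contribute
    logarithms. The threshold M balances two errors: sieving by primes above M loses a proportion
    O(log B / M) = O(1 / log B) of the volume, which the second term absorbs, while only O(log log
    B) dyadic sizes per coordinate lie below M. Sides of length at least M also make residues modulo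
    p <= M well distributed. Codimension is given as the absence of a long chain of primes, so the
    eliminating polynomials come by contraposition: a nonconstant common divisor in one variable
    forces a chain of length k - 1, which is written down explicitly. The sieve works only for
    primes above a constant [p0] depending on Z. For smaller N the product N log N is bounded and
    the count of all points suffices, whence the uniformity in N. *)

Lemma mpoly_morph_ext n (R S : comNzRingType)
    (f g : {rmorphism {mpoly R[n]} -> S}) :
  (forall c, f c%:MP = g c%:MP) -> (forall i, f 'X_i = g 'X_i) -> f =1 g.
Proof.
move=> fgC fgX p; rewrite (mpolyE p) !rmorph_sum /=; apply: eq_bigr => m _.
rewrite -mul_mpolyC !rmorphM /= fgC (mpolyXE_id R m) !rmorph_prod /=; congr (_ * _).
by apply: eq_bigr => i _; rewrite !rmorphXn /= fgX.
Qed.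

Definition seqeval n (R : comNzRingType) (s : seq R) (p : {mpoly R[n]}) : R :=
  meval (fun i : 'I_n => s`_i) p.

HB.instance Definition _ n (R : comNzRingType) (s : seq R) :=
  GRing.RMorphism.copy (@seqeval n R s) (meval (fun i : 'I_n => s`_i)).

Lemma muniX_max n (R : comNzRingType) : muni 'X_(@ord_max n) = 'X :> {poly {mpoly R[n]}}.
Proof.
rewrite muniE msuppX big_seq1 mcoeffX eqxx scale1r mnm1E eqxx expr1.
rewrite (_ : [multinom _ | _ < _] = 0%MM) ?mpolyX0 ?scale1r //.
apply/mnmP => i; rewrite mnmE mnm0E mnm1E.
by case: eqP => // /(congr1 val) /= E; have := ltn_ord i; rewrite -E ltnn.
Qed.

Lemma muniX_widen n (R : comNzRingType) (i : 'I_n) :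
  muni 'X_(widen_ord (leqnSn n) i) = ('X_i)%:P :> {poly {mpoly R[n]}}.
Proof.
rewrite muniE msuppX big_seq1 mcoeffX eqxx scale1r mnm1E.
rewrite (_ : (_ == _) = false) ?expr0; last first.
  by apply/eqP => /(congr1 val) /= E; have := ltn_ord i; rewrite E ltnn.
rewrite (_ : [multinom _ | _ < _] = U_(i)%MM) ?alg_polyC //.
by apply/mnmP => j; rewrite mnmE !mnm1E.
Qed.

Lemma seqeval_rcons n (R : comNzRingType) (s : seq R) y (p : {mpoly R[n.+1]}) :
  size s = n -> seqeval (rcons s y) p = (map_poly (seqeval s) (muni p)).[y].
Proof.
move=> ss.
have := @mpoly_morph_ext n.+1 R R (seqeval (rcons s y))
  (horner_eval y \o map_poly (seqeval s) \o @muni n R) _ _ p.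
rewrite /= /horner_eval; apply.
  move=> c /=; rewrite /seqeval mevalC.
  by rewrite muniC map_polyC /= hornerC mevalC.
move=> i /=; rewrite /seqeval mevalXU.
have [-> | ne] := eqVneq i ord_max.
  by rewrite muniX_max map_polyX hornerX nth_rcons ss ltnn eqxx.
have lin : (i < n)%N.
  by have := ltn_ord i; rewrite ltnS leq_eqVlt => /orP[/eqP E|//]; case/eqP: ne; apply: val_inj.
rewrite (_ : i = widen_ord (leqnSn n) (Ordinal lin)); last exact: val_inj.
by rewrite muniX_widen map_polyC hornerC /= mevalXU nth_rcons ss lin.
Qed.

(** Widening the coefficients and substituting the last variable for ['X] is a left inverse of
    [muni]. *)
Lemma muni_eq0 n (R : comNzRingType) (p : {mpoly R[n.+1]}) : muni p = 0 -> p = 0.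
Proof.
have := @mpoly_morph_ext n.+1 R {mpoly R[n.+1]}
  (horner_eval 'X_ord_max \o map_poly (@mwiden n R) \o @muni n R) idfun _ _ p.
rewrite /= /horner_eval => K p0; rewrite -K ?p0 ?map_poly0 ?horner0 //.
  by move=> c /=; rewrite muniC map_polyC /= hornerC mwidenC.
move=> i /=; have [-> | ne] := eqVneq i ord_max.
  by rewrite muniX_max map_polyX hornerX.
have lin : (i < n)%N.
  by have := ltn_ord i; rewrite ltnS leq_eqVlt => /orP[/eqP E|//]; case/eqP: ne; apply: val_inj.
rewrite (_ : i = widen_ord (leqnSn n) (Ordinal lin)); last exact: val_inj.
by rewrite muniX_widen map_polyC hornerC /= mwidenX mnmwiden1.
Qed.

Lemma poly_nat_nonroot (R : numDomainType) (p : {poly R}) :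
  p != 0 -> exists y : nat, p.[y%:R] != 0.
Proof.
move=> p0; pose rs : seq R := [seq i%:R | i <- iota 0 (size p)].
have urs : uniq rs.
  by rewrite map_inj_uniq ?iota_uniq // => i j /eqP; rewrite eqr_nat => /eqP.
have := max_poly_roots p0 _ urs; rewrite size_map size_iota ltnn => H.
have /allPn[_ /mapP[y _ ->] ry] : ~~ all (root p) rs by apply/negP => /H.
by exists y.
Qed.

Lemma mpoly_nat_nonzero n (R : numDomainType) (p : {mpoly R[n]}) :
  p != 0 -> exists2 s : seq nat, size s = n & seqeval [seq i%:R | i <- s] p != 0.
Proof.
elim: n p => [|n IH] p p0.
  exists [::] => //; apply: contraNN p0 => /eqP E; apply/eqP.
  have [c pE] : exists c, p = c%:MP.
    exists (p@_0%MM); apply/mpolyP => m; rewrite mcoeffC.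
    by rewrite (_ : m = 0%MM) ?eqxx ?mulr1 //; apply/mnmP => -[].
  by move: E; rewrite pE /seqeval mevalC => ->; rewrite mpolyC0.
have : muni p != 0 by apply: contraNN p0 => /eqP/muni_eq0 ->.
rewrite -lead_coef_eq0 => /IH[s ss]; rewrite lead_coefE => Hs.
have : map_poly (seqeval [seq i%:R | i <- s]) (muni p) != 0.
  by apply: contraNN Hs => /eqP E; rewrite -coef_map E coef0.
move=> /poly_nat_nonroot[y Hy]; exists (rcons s y); first by rewrite size_rcons ss.
by rewrite map_rcons seqeval_rcons // size_map.
Qed.

(** * Hensel's lemma *)

(* Power series in z over E are handled through their truncations in {poly E}: [zdiv n p] is
   the congruence p = 0 mod z^n. *)
Definition zdiv (E : comNzRingType) n (p : {poly E}) := exists r, p = r * 'X^n.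

Lemma zdivP (E : comNzRingType) n (p : {poly E}) :
  zdiv n p <-> forall i, (i < n)%N -> p`_i = 0.
Proof.
split=> [[r ->] i lin|H]; first by rewrite coefMXn lin.
exists (drop_poly n p); rewrite -[LHS](poly_take_drop n) (_ : take_poly n p = 0) ?add0r //.
by apply/polyP => i; rewrite coef_take_poly coef0; case: ifP => // /H.
Qed.

Lemma zdivD (E : comNzRingType) n (p q : {poly E}) : zdiv n p -> zdiv n q -> zdiv n (p + q).
Proof. by move=> [r ->] [s ->]; exists (r + s); rewrite mulrDl. Qed.

Lemma zdivMl (E : comNzRingType) n (p q : {poly E}) : zdiv n q -> zdiv n (p * q).
Proof. by move=> [r ->]; exists (p * r); rewrite mulrA. Qed.

Lemma zdiv0 (E : comNzRingType) n : zdiv n (0 : {poly E}).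
Proof. by exists 0; rewrite mul0r. Qed.

Lemma zdivW (E : comNzRingType) m n (p : {poly E}) : (m <= n)%N -> zdiv n p -> zdiv m p.
Proof. by move=> mn /zdivP H; apply/zdivP => i im; apply: H; apply: leq_trans mn. Qed.

Lemma zdiv_map (E E' : comNzRingType) (f : {rmorphism E -> E'}) n (p : {poly E}) :
  zdiv n p -> zdiv n (map_poly f p).
Proof. by move=> [r ->]; exists (map_poly f r); rewrite rmorphM /= map_polyXn. Qed.

(** Orders of vanishing at z = 0 add up over a domain. This truncated form of the fact that power
    series over a domain form a domain makes the ideals of the chain prime. *)
Lemma zdiv_mul (E : idomainType) m n (p q : {poly E}) :
  zdiv (m + n).+1 (p * q) -> zdiv m.+1 p \/ zdiv n.+1 q.
Proof.
have low (a : {poly E}) k : ~ zdiv k.+1 a ->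
    exists2 i, (i <= k)%N & a`_i != 0 /\ zdiv i a.
  move=> H; have ex : exists i, a`_i != 0.
    case: (boolP [exists i : 'I_k.+1, a`_i != 0]) => [/existsP[i ?]|/existsPn N].
      by exists i.
    case: H; apply/zdivP => i ik; apply/eqP; rewrite -[_ == _]negbK.
    by have := N (Ordinal ik).
  case: (ex_minnP ex) => i ai mi; exists i.
    rewrite leqNgt; apply/negP => ki; apply: H; apply/zdivP => j jk.
    apply/eqP; apply: contraLR (leq_trans jk ki) => /mi; rewrite -leqNgt; exact.
  split=> //; apply/zdivP => j ji; apply/eqP; apply: contraLR ji => /mi.
  by rewrite -leqNgt.
move=> H; case: (boolP [forall i : 'I_m.+1, p`_i == 0]) => [/forallP A|].
  by left; apply/zdivP => i im; apply/eqP; apply: (A (Ordinal im)).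
move=> /forallPn[i pi]; right; apply/zdivP => j; rewrite ltnS => jn.
have [a am [pa [p1 pE]]] : exists2 i, (i <= m)%N & p`_i != 0 /\ zdiv i p.
  by apply: low => /zdivP A; move: pi; rewrite A ?eqxx.
apply/eqP/negPn/negP => qj.
have [b bn [qb [q1 qE]]] : exists2 i, (i <= n)%N & q`_i != 0 /\ zdiv i q.
  by apply: low => /zdivP A; move: qj; rewrite A ?eqxx.
have /zdivP/(_ (a + b)%N) := H; rewrite ltnS leq_add // => /(_ isT).
have -> : p * q = p1 * q1 * 'X^(a + b) by rewrite pE qE exprD mulrACA.
rewrite coefMXn ltnn subnn -!horner_coef0 hornerM => /eqP.
move: pa qb; rewrite pE qE !coefMXn !ltnn !subnn -!horner_coef0.
by rewrite mulf_eq0 => /negbTE -> /negbTE ->.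
Qed.

Lemma horner_taylor2 (R : comNzRingType) (p : {poly R}) x h :
  exists r, p.[x + h] = p.[x] + p^`().[x] * h + r * h ^+ 2.
Proof.
elim/poly_ind: p => [|p c [r IH]]; first by exists 0; rewrite deriv0 !horner0; ring.
exists (p^`().[x] + r * (x + h)); rewrite derivD derivM derivX derivC !hornerE IH /=; ring.
Qed.

Lemma horner_eval0 (E : comNzRingType) (q : {poly {poly E}}) (y : {poly E}) :
  (q.[y]).[0] = (map_poly (horner_eval 0) q).[y.[0]].
Proof. by rewrite -[RHS]/((map_poly (horner_eval 0) q).[horner_eval 0 y]) horner_map. Qed.

(** Newton iteration, one coefficient at a time. [E] need not be a field, so an inverse [e] of the
    derivative at [th] is supplied. *)
Lemma newton_series (E : comNzRingType) (q : {poly {poly E}}) (th e : E) :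
  (map_poly (horner_eval 0) q).[th] = 0 ->
  (map_poly (horner_eval 0) q)^`().[th] * e = 1 ->
  exists phi : nat -> {poly E},
    [/\ forall N, (phi N).[0] = th,
        forall N, zdiv N.+1 q.[phi N]
      & forall N, zdiv N.+1 (phi N.+1 - phi N)].
Proof.
move=> q0 q1.
pose step N (y : {poly E}) := y + (- (q.[y])`_N.+1 * e)%:P * 'X^(N.+1).
pose phi := fix phi N := if N is N'.+1 then step N' (phi N') else th%:P.
have phi0 N : (phi N).[0] = th.
  elim: N => [|N IH] /=; first by rewrite hornerC.
  by rewrite /step !hornerE IH expr0n mulr0 addr0.
exists phi; split=> // N; last first.
  by rewrite /= /step addrC addKr; exists (- (q.[phi N])`_N.+1 * e)%:P.
elim: N => [|N [r IH]].
  by apply/zdivP => -[] // _; rewrite -horner_coef0 horner_eval0 phi0.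
rewrite [phi _]/= /step; set c := _%:P.
have [s ->] := horner_taylor2 q (phi N) (c * 'X^(N.+1)).
have cE : c = (- r`_0 * e)%:P by rewrite /c IH coefMXn ltnn subnn.
have -> : q.[phi N] + q^`().[phi N] * (c * 'X^(N.+1)) + s * (c * 'X^(N.+1)) ^+ 2
   = (r + q^`().[phi N] * c + s * c ^+ 2 * 'X^(N.+1)) * 'X^(N.+1).
  by rewrite IH; ring.
(* The constant term of this cofactor of z^(N+1) is r_0 - q'(th) e r_0 = 0, so one more power of z
   splits off. *)
set b := (X in X * _).
suff [b' ->] : zdiv 1 b by exists b'; rewrite -mulrA -exprD.
apply/zdivP => -[] // _; rewrite -horner_coef0 /b cE !hornerE.
rewrite horner_eval0 -deriv_map phi0 -horner_coef0 expr0n /= mulr0 addr0.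
set u := _.[th] in q1 *; set w := r.[0].
by rewrite mulrN mulNr mulrAC q1 mul1r subrr.
Qed.

(** * Chains of primes on a hypersurface *)

(* The variable i becomes 'X; the i-th variable of the coefficient ring is then an unused
   transcendental, which spares a renaming of the variables. *)
Definition polyin k (R : comNzRingType) (i : 'I_k) : {mpoly R[k]} -> {poly {mpoly R[k]}} :=
  mmap (polyC \o @mpolyC k R) (fun j => if j == i then 'X else ('X_j)%:P).

HB.instance Definition _ k (R : comNzRingType) (i : 'I_k) :=
  GRing.RMorphism.copy (@polyin k R i)
    (mmap (polyC \o @mpolyC k R) (fun j => if j == i then 'X else ('X_j)%:P)).

Lemma horner_sub_zdiv (E : comNzRingType) n (p : {poly {poly E}}) (x y : {poly E}) :
  zdiv n (x - y) -> zdiv n (p.[x] - p.[y]).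
Proof.
move=> H; have [r E1] := horner_taylor2 p y (x - y).
rewrite addrC subrK in E1; rewrite E1 (_ : _ - _ = (p^`().[y] + r * (x - y)) * (x - y)).
  exact: zdivMl.
ring.
Qed.

(* Take a point (y, th) of V(q) with q_x(y, th) <> 0. By Hensel's lemma V(q) is parametrised there
   by x_j = y_j + t_j z for j <> i and x_i = phi, a power series in z over the polynomials in t.
   Since those power series form a domain, the polynomials vanishing on this parametrisation form a
   prime ideal, and so do those vanishing once the first j parameters t are set to 0. *)
Section Chain.
Variables (k : nat) (cones : seq {set 'I_k}) (F : seq {mpoly rat[k]}).
Variables (i : 'I_k) (y : 'I_k -> rat) (q u w : {poly {mpoly rat[k]}}).
Variables (d : {mpoly rat[k]}) (s : {set 'I_k}).
Hypothesis sz_q : (1 < size q)%N.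
Hypothesis lead_q : meval y (lead_coef q) != 0.
Hypothesis bez : u * q + w * (q^`() * polyin i (cox_monomial_compl s)) = d%:P.
Hypothesis d_y : meval y d != 0.
Hypothesis qF : forall f, f \in F -> exists c g,
  meval y c != 0 /\ c *: polyin i f = g * q.

Let E := {mpoly algC[k]}.
Let cst : {rmorphism rat -> {poly E}} := polyC \o @mpolyC k algC \o ratr.
Let wpt (j : 'I_k) : {poly E} := cst (y j) + (if j == i then 0 else ('X_j)%:P * 'X).
Let evD : {rmorphism {mpoly rat[k]} -> {poly E}} := mmap cst wpt.
Let evy : {rmorphism {mpoly rat[k]} -> algC} := ratr \o meval y.

Let evD0 f : (evD f).[0] = (evy f)%:MP.
Proof.
apply: (@mpoly_morph_ext k _ _ (horner_eval 0 \o evD) (@mpolyC k algC \o evy)) => [c|j] /=.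
  by rewrite /horner_eval mmapC /= hornerC mevalC.
rewrite /horner_eval mmapX mmap1U mevalXU /wpt /= !hornerE.
by case: ifP => _; rewrite !hornerE.
Qed.

Let qw := map_poly evD q.
Let qy := map_poly evy q.

Let qw0 : map_poly (horner_eval 0) qw = map_poly (@mpolyC k algC) qy.
Proof. by rewrite -!map_poly_comp; apply: eq_map_poly => f /=; rewrite /horner_eval evD0. Qed.

Let root_qy : exists th, root qy th.
Proof.
apply/closed_rootP; rewrite size_poly_eq ?neq_ltn ?sz_q ?orbT // -lead_coefE.
by rewrite /evy /= fmorph_eq0.
Qed.

Lemma chain_dim : s \in cones -> cone_dim_ge cones F k.-1.
Proof.
move=> s_in; have [th qth] := root_qy; have qth0 := rootP qth.
(* At (y, th) the first Bezout term vanishes, so both factors next to w are nonzero: q' starts the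
   Newton iteration, and the Cox monomial is avoided by the last prime of the chain. *)
have evy_bez : (map_poly evy w).[th] * (qy^`().[th] *
    (map_poly evy (polyin i (cox_monomial_compl s))).[th]) = evy d.
  have := congr1 (fun p => (map_poly evy p).[th]) bez.
  by rewrite rmorphD !rmorphM /= !hornerE -deriv_map qth0 mulr0 add0r map_polyC hornerC.
have evyd : evy d != 0 by rewrite fmorph_eq0.
have [qy'0 xs0] : qy^`().[th] != 0 /\
    (map_poly evy (polyin i (cox_monomial_compl s))).[th] != 0.
  by move: evyd; rewrite -evy_bez !mulf_eq0 !negb_or => /and3P[].
have [phi [phi0 phiq phiS]] : exists phi : nat -> {poly E},
    [/\ forall N, (phi N).[0] = th%:MP, forall N, zdiv N.+1 qw.[phi N]
      & forall N, zdiv N.+1 (phi N.+1 - phi N)].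
  apply: (@newton_series _ _ _ ((qy^`().[th])^-1)%:MP).
    by rewrite qw0 horner_map /= qth0 mpolyC0.
  by rewrite qw0 deriv_map horner_map /= -mpolyCM divff.
pose ev N : {rmorphism {mpoly rat[k]} -> {poly E}} :=
  mmap cst (fun j => if j == i then phi N else wpt j).
have evE N f : ev N f = (map_poly evD (polyin i f)).[phi N].
  apply: (@mpoly_morph_ext k _ _ (ev N)
    (horner_eval (phi N) \o map_poly evD \o @polyin k rat i)) => [c|j] /=.
    by rewrite /horner_eval /polyin !mmapC /= map_polyC /= mmapC hornerC.
  rewrite /horner_eval /polyin !mmapX !mmap1U; case: ifP => ji.
    by rewrite map_polyX hornerX.
  by rewrite map_polyC hornerC /= mmapX mmap1U.
have ev0 N f : (ev N f).[0] = ((map_poly evy (polyin i f)).[th])%:MP.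
  rewrite evE horner_eval0 phi0 -map_poly_comp.
  rewrite -[RHS](horner_map (@mpolyC k algC)) -map_poly_comp /=; congr (_.[_]).
  by apply: eq_map_poly => g /=; rewrite /horner_eval evD0.
have evS M N f : (N <= M)%N -> zdiv N.+1 (ev M f - ev N f).
  move=> /subnKC <-; elim: (M - N)%N => [|m IH]; first by rewrite addn0 subrr; apply: zdiv0.
  rewrite addnS; have -> : ev (N + m).+1 f - ev N f
    = (ev (N + m).+1 f - ev (N + m)%N f) + (ev (N + m)%N f - ev N f) by rewrite addrA subrK.
  apply: zdivD IH; rewrite !evE; apply: horner_sub_zdiv.
  by apply: zdivW (phiS _); rewrite ltnS leq_addr.
(* [lift i] numbers the k - 1 parameters other than t_i; [sg j] sets the first j of them to 0. *)
pose killed j (l : 'I_k) := [exists l' : 'I_k.-1, (l' < j)%N && (l == lift i l')].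
pose sg j : {rmorphism E -> E} :=
  mmap (@mpolyC k algC) (fun l => if killed j l then 0 else 'X_l).
have sgC j c : sg j c%:MP = c%:MP by rewrite /= mmapC.
have sg0 f : sg 0%N f = f.
  apply: (@mpoly_morph_ext k _ _ (sg 0%N) idfun) => [c|l] /=; first by rewrite mmapC.
  by rewrite mmapX mmap1U ifF //; apply/existsP => -[].
have sgS j f : sg j.+1 (sg j f) = sg j.+1 f.
  apply: (@mpoly_morph_ext k _ _ (sg j.+1 \o sg j) (sg j.+1)) => [c|l] /=.
    by rewrite !mmapC.
  rewrite !mmapX !mmap1U; case: ifP => [kj|_]; last by rewrite mmapX mmap1U.
  rewrite rmorph0 ifT //; case/existsP: kj => l' /andP[lj ll]; apply/existsP.
  by exists l'; rewrite ll ltnS ltnW.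
have [es esE] : exists es : nat -> nat -> {rmorphism {mpoly rat[k]} -> {poly E}},
    forall j N f, es j N f = map_poly (sg j) (ev N f).
  by exists (fun j N => map_poly (sg j) \o ev N).
pose P j f := forall N, zdiv N.+1 (es j N f).
exists s => //; exists P; split.
- move=> j _; split.
  + split=> [N|f g Hf Hg N|f g Hg N]; first by rewrite (rmorph0 (es j N)); apply: zdiv0.
      by rewrite (rmorphD (es j N)); apply: zdivD.
    by rewrite (rmorphM (es j N)); apply: zdivMl.
  + move=> /(_ 0%N); rewrite (rmorph1 (es j 0%N)) => /zdivP/(_ 0%N isT)/eqP.
    by rewrite coef1 oner_eq0.
  + move=> f g Hfg; apply: contrapT => /not_orP[/existsNP[N1 H1] /existsNP[N2 H2]].
    (* Higher precision determines lower precision, so the failures of f at N1 and of g at N2 are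
       both visible at precision N1 + N2, where [zdiv_mul] applies. *)
    have coh M N h : (N <= M)%N -> zdiv N.+1 (es j M h) -> zdiv N.+1 (es j N h).
      move=> NM H; have -> : es j N h = es j M h + (-1) * map_poly (sg j) (ev M h - ev N h).
        rewrite (_ : map_poly _ _ = es j M h - es j N h); last by rewrite !esE; apply: rmorphB.
        by rewrite mulN1r opprB addrC subrK.
      by apply: zdivD H _; apply/zdivMl/zdiv_map/evS.
    have := Hfg (N1 + N2)%N; rewrite (rmorphM (es j _)) => /zdiv_mul[].
      by move/(coh _ _ _ (leq_addr _ _)).
    by move/(coh _ _ _ (leq_addl _ _)).
- move=> f /qF[c [g [cy cE]]] N.
  have -> : es 0%N N f = ev N f.
    by apply/polyP => l; rewrite esE coef_map /= sg0.
  have H1 : evD c *: map_poly evD (polyin i f) = map_poly evD g * qw.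
    by rewrite -map_polyZ cE; apply: rmorphM.
  have H : evD c * ev N f = (map_poly evD g).[phi N] * qw.[phi N].
    by rewrite -[RHS]hornerM -H1 hornerZ evE.
  (* [evD c] has the nonzero constant term c(y), so the whole order of vanishing passes to
     [ev N f]. *)
  have : zdiv (0 + N).+1 (evD c * ev N f) by rewrite H; apply: zdivMl.
  case/zdiv_mul => // /zdivP/(_ 0%N isT)/eqP.
  by rewrite -horner_coef0 evD0 mpolyC_eq0 fmorph_eq0 (negbTE cy).
- move=> j jk; split.
    move=> f Hf N; have := zdiv_map (sg j.+1) (Hf N).
    rewrite !esE -map_poly_comp; suff -> : map_poly (sg j.+1 \o sg j) (ev N f) =
      map_poly (sg j.+1) (ev N f) by [].
    by apply: eq_map_poly => g; apply: sgS.
  (* X_l - y_l becomes t_l z on the parametrisation; it vanishes once t_l is set to 0 and not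
     before, which separates [P j] from [P j.+1]. *)
  pose l := lift i (Ordinal jk).
  have li : (l == i) = false by rewrite eq_sym (negbTE (neq_lift _ _)).
  have evl N : ev N ('X_l - (y l)%:MP) = ('X_l)%:P * 'X.
    by rewrite rmorphB /= mmapX mmap1U mmapC li /wpt li addrC addKr.
  exists ('X_l - (y l)%:MP); split.
    move=> N; rewrite esE evl rmorphM /= map_polyC /= mmapX mmap1U ifT ?mul0r; first exact: zdiv0.
    by apply/existsP; exists (Ordinal jk); rewrite ltnSn eqxx.
  move=> /(_ 1%N); rewrite esE evl rmorphM /= map_polyC /= mmapX mmap1U ifF; last first.
    apply/existsP => -[l' /andP[l'j /eqP/lift_inj/(congr1 val) /= E1]].
    by rewrite -E1 ltnn in l'j.
  move=> /zdivP/(_ 1%N isT)/eqP; rewrite map_polyX coefMX coefC /=.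
  by rewrite -msupp_eq0 msuppX.
- move=> /(_ 0%N)/zdivP/(_ 0%N isT)/eqP.
  by rewrite esE coef_map -horner_coef0 ev0 /= mmapC mpolyC_eq0 (negbTE xs0).
Qed.

End Chain.

(** * Elimination of one variable from the ideal of Z *)

Section Elimination.
Import Pdiv.Idomain.

(** Stated through all ideals containing [S]: taking for [J] the polynomials that vanish at a point
    gives vanishing there at once. *)
Definition ideal_gen (R : comNzRingType) (S : seq R) (p : R) := forall J : R -> Prop,
  J 0 -> (forall a b, J a -> J b -> J (a + b)) -> (forall a b, J b -> J (a * b)) ->
  (forall f, f \in S -> J f) -> J p.

Lemma ideal_gen_morph (R R' : comNzRingType) (f : {rmorphism R -> R'}) S p :
  ideal_gen S p -> ideal_gen (map f S) (f p).
Proof.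
move=> H J J0 JD JM JS; apply: (H (fun a => J (f a))) => [|a b|a b|g gS].
- by rewrite rmorph0.
- by rewrite rmorphD; apply: JD.
- by rewrite rmorphM; apply: JM.
- by apply: JS; apply: map_f.
Qed.

(** Over the fraction field the gcd is a combination of [S]; [c] clears the denominators of that
    combination. *)
Lemma ideal_gen_gcdp (D : idomainType) (S : seq {poly D}) :
  exists2 G : {poly D}, forall f, f \in S -> G %| f &
    exists2 c, c != 0 & ideal_gen S (c *: G).
Proof.
elim: S => [|f S [G GS [c c0 cG]]].
  by exists 0 => //; exists 1; [apply: oner_neq0 | move=> J ? *; rewrite scaler0].
exists (gcdp f G) => [h|].
  rewrite inE => /orP[/eqP -> |/GS]; first exact: dvdp_gcdl.
  exact/dvdp_trans/dvdp_gcdr.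
have [[u v] /= /eqpP[[a b] /= /andP[a0 b0] abE]] := Bezoutp f G.
exists (c * b); first by rewrite mulf_neq0.
move=> J J0 JD JM JS.
have JG : J (c *: G) by apply: cG => // h hS; apply: JS; rewrite inE hS orbT.
rewrite -scalerA -abE (_ : c *: _ = (c * a)%:P * u * f + a%:P * v * (c *: G)).
  by apply: JD; apply: JM => //; apply: JS; rewrite inE eqxx.
by rewrite -!mul_polyC polyCM; ring.
Qed.

(** A nonconstant divisor of least degree is irreducible over the fraction field: [gcdp q p] is
    either constant or has the degree of [q]. *)
Lemma min_divisor (D : idomainType) (G : {poly D}) : size G != 1%N ->
  exists q : {poly D}, [/\ (1 < size q)%N, q %| G & forall p, coprimep q p \/ q %| p].
Proof.
move=> sG; pose P n := `[< exists q : {poly D}, [/\ size q = n, (1 < n)%N & q %| G] >].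
have exP : exists n, P n.
  have [G0|G0] := eqVneq G 0.
    by exists 2%N; apply/asboolP; exists 'X; rewrite size_polyX G0 dvdp0.
  exists (size G); apply/asboolP; exists G; rewrite dvdpp; split=> //.
  by move: G0 sG; rewrite -size_poly_eq0; case: (size G) => [|[]].
case: (ex_minnP exP) => n /asboolP[q [sq n1 qG]] mn; exists q; rewrite sq; split=> // p.
have [cp|ncp] := boolP (coprimep q p); [by left | right].
have q0 : q != 0 by rewrite -size_poly_eq0 sq; case: (n) n1.
have dq : gcdp q p %| q := dvdp_gcdl _ _.
suff : gcdp q p %= q by move=> /eqp_dvdl <-; apply: dvdp_gcdr.
rewrite -dvdp_size_eqp // eqn_leq dvdp_leq //= sq; apply: mn; apply/asboolP.
exists (gcdp q p); split=> //; last exact: dvdp_trans qG.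
move: ncp; rewrite /coprimep; have : gcdp q p != 0 by rewrite gcdp_eq0 (negbTE q0).
by rewrite -size_poly_eq0; case: (size _) => [|[]].
Qed.

Lemma mpoly_mulrn_neq0 k (R : numDomainType) (p : {mpoly R[k]}) n :
  p != 0 -> p *+ n.+1 != 0.
Proof.
rewrite -!msupp_eq0; apply: contraNN => /eqP H; rewrite -size_eq0; apply/eqP.
case E : (msupp p) => [|m r] //.
have : m \in msupp p by rewrite E inE eqxx.
rewrite mcoeff_msupp => /negP[]; have : m \notin msupp (p *+ n.+1) by rewrite H.
by rewrite mcoeff_msupp negbK mcoeffMn mulrn_eq0.
Qed.

(* If the gcd G of the f in F as polynomials in the variable i is a constant, Bezout gives an element
   of the ideal without the variable i. Otherwise G has an irreducible divisor q, separable in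
   characteristic 0, and V(q) carries a chain of primes of length k - 1. *)
Lemma elimination k (cones : seq {set 'I_k}) (F : seq {mpoly rat[k]}) (i : 'I_k) :
  (forall rho, exists2 s, s \in cones & rho \in s) ->
  codim_ge2 cones F ->
  exists h : {mpoly rat[k]}, [/\ ideal_gen F h,
    exists2 s : seq nat, size s = k & seqeval [seq a%:R | a <- s] h != 0
  & forall x y : 'I_k -> rat, (forall j, j != i -> x j = y j) -> meval x h = meval y h].
Proof.
move=> cov codim.
have [G GF [c c0 cG]] := ideal_gen_gcdp [seq polyin i f | f <- F].
have [/size_poly1P[g g0 GE]|sG] := boolP (size G == 1%N).
  pose d := c * g; have d0 : d != 0 by rewrite mulf_neq0.
  have dJ : ideal_gen [seq polyin i f | f <- F] d%:P.
    by move: cG; rewrite GE -mul_polyC -polyCM.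
  have [s ss sd] := mpoly_nat_nonzero d0.
  pose b : rat := (nth 0%N s i)%:R.
  pose sub : {rmorphism {mpoly rat[k]} -> {mpoly rat[k]}} :=
    mmap (@mpolyC k rat) (fun j => if j == i then b%:MP else 'X_j).
  pose psi : {rmorphism {poly {mpoly rat[k]}} -> {mpoly rat[k]}} := horner_eval 'X_i \o map_poly sub.
  have psiK f : psi (polyin i f) = f.
    apply: (@mpoly_morph_ext k _ _ (psi \o @polyin k rat i) idfun) => [a|j] /=.
      by rewrite /psi /= /horner_eval /polyin mmapC /= map_polyC hornerC /= mmapC.
    rewrite /psi /= /horner_eval /polyin mmapX mmap1U; case: ifP => ji.
      by rewrite map_polyX hornerX (eqP ji).
    by rewrite map_polyC hornerC /= mmapX mmap1U ji.
  have subE x f : meval x (sub f) = meval (fun j => if j == i then b else x j) f.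
    apply: (@mpoly_morph_ext k _ _ (meval x \o sub)) => [a|j] /=.
      by rewrite mmapC !mevalC.
    by rewrite mmapX mmap1U mevalXU; case: ifP => _; rewrite ?mevalC ?mevalXU.
  exists (sub d); split.
  - have := @ideal_gen_morph _ _ psi _ _ dJ.
    rewrite -map_comp (eq_map psiK) map_id.
    by rewrite /psi /= /horner_eval map_polyC hornerC.
  - exists s => //; rewrite /seqeval subE; move: sd; rewrite /seqeval; congr (_ != _).
    apply: meval_eq => j; case: eqP => // ->.
    by rewrite (nth_map 0%N) // ss.
  - by move=> x y xy; rewrite !subE; apply: meval_eq => j; case: ifP => // /negbT /xy.
have [q [sq qG qp]] := min_divisor sG.
(* The cone contains the ray i, so its complementary monomial is free of the variable i and counts
   as a constant in the divisibility by [q]. *)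
have [s s_in si] := cov i.
have [xc xc0 xE] : exists2 a, a != 0 & polyin i (cox_monomial_compl s) = a%:P.
  exists (\prod_(rho < k | rho \notin s) 'X_rho).
    by apply/prodf_neq0 => j _; rewrite -msupp_eq0 msuppX.
  rewrite /cox_monomial_compl !rmorph_prod /=; apply: eq_bigr => j js.
  have -> : mX j = U_(j)%MM by apply/mnmP => l; rewrite mnm1E mnmE eq_sym.
  by rewrite /polyin mmapX mmap1U ifF //; apply: contraNF js => /eqP ->.
have q0 : q != 0 by rewrite -size_poly_eq0; case: (size q) sq.
have lq : lead_coef q != 0 by rewrite lead_coef_eq0.
have q'0 : q^`() != 0.
  apply: contraNN lq => /eqP E.
  have szE : (size q).-1 = (size q).-2.+1 by case: (size q) sq => [|[]].
  have : q`_(size q).-1 *+ (size q).-1 = 0 by rewrite szE -coef_deriv E coef0.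
  by rewrite szE lead_coefE szE => H; apply/negPn/negP => /mpoly_mulrn_neq0 /eqP; apply; exact: H.
have : coprimep q (q^`() * polyin i (cox_monomial_compl s)).
  case: (qp (q^`() * polyin i (cox_monomial_compl s))) => //.
  rewrite xE mulrC mul_polyC dvdpZr // => /(dvdp_leq q'0).
  by rewrite leqNgt lt_size_deriv.
move=> /Bezout_coprimepP[[u w] /= /eqpP[[a b] /= /andP[a0 b0] abE]].
have [y ys] := mpoly_nat_nonzero (mulf_neq0 lq b0).
rewrite rmorphM mulf_eq0 negb_or => /andP[ly by_].
case: codim; apply: (@chain_dim k cones F i (fun j => [seq a%:R | a <- y]`_j) q
  (a *: u) (a *: w) b s) => //.
  by rewrite -[b%:P]alg_polyC -abE scalerDr !scalerAl.
(* Pseudo-division multiplies f by a power of the leading coefficient of [q], which is nonzero at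
   y. *)
move=> f fF; exists (lead_coef q ^+ scalp (polyin i f) q), (polyin i f %/ q); split.
  by rewrite rmorphXn expf_neq0.
apply/eqP; rewrite -dvdp_eq; apply: dvdp_trans qG _; apply: GF; exact: map_f.
Qed.

Lemma mpoly_int_scale k (p : {mpoly rat[k]}) : exists e : int, e != 0 /\
  exists H : {mpoly int[k]}, map_mpoly intr H = e%:~R *: p.
Proof.
elim/mpolyind: p => [|c m p _ _ [e [e0 [H HE]]]].
  by exists 1; split=> //; exists 0; rewrite rmorph0 scaler0.
exists (denq c * e); split; first by rewrite mulf_neq0 // denq_neq0.
exists ((numq c * e) *: 'X_[m] + (denq c) *: H).
rewrite rmorphD /= !map_mpolyZ HE map_mpolyX scalerDr !scalerA !rmorphM /= numqE.
by congr (_ *: _ + _); ring.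
Qed.

(** Denominators are cleared because reduction into the closure of Z is tested on integer
    polynomials. *)
Lemma closure_elimination k (cones : seq {set 'I_k}) (F : seq {mpoly rat[k]}) (i : 'I_k) :
  (forall rho, exists2 s, s \in cones & rho \in s) ->
  codim_ge2 cones F ->
  exists H : {mpoly int[k]}, [/\ in_closure_ideal cones F H,
    exists2 s : seq int, size s = k & seqeval s H != 0
  & forall x y : seq int, (forall j : 'I_k, j != i -> x`_j = y`_j) ->
      seqeval x H = seqeval y H].
Proof.
move=> cov codim; have [h [hI [s ss hs] hx]] := elimination i cov codim.
have [e [e0 [H HE]]] := mpoly_int_scale h.
have evH (x : seq int) : (seqeval x H)%:~R = e%:~R * meval (fun j : 'I_k => (x`_j)%:~R) h.
  rewrite -mevalZ -HE /seqeval.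
  apply: (@mpoly_morph_ext k _ _ (intr \o meval (fun j : 'I_k => x`_j))
    (meval (fun j : 'I_k => (x`_j)%:~R) \o map_mpoly intr)) => [a|j] /=.
    by rewrite map_mpolyC !mevalC.
  by rewrite map_mpolyX !mevalXU.
exists H; split.
- move=> x [_ Fx].
  have hx0 : meval x (map_mpoly ratr h) = 0.
    apply: (hI (fun f => meval x (map_mpoly ratr f) = 0)) => [|a b A B|a b A|f fF].
    + by rewrite !rmorph0.
    + by rewrite !rmorphD /= A B addr0.
    + by rewrite !rmorphM /= A mulr0.
    + exact: Fx.
  have -> : map_mpoly (fun z : int => z%:~R) H = map_mpoly ratr (map_mpoly intr H) :> {mpoly algC[k]}.
    apply: (@mpoly_morph_ext k _ _ (map_mpoly intr)
      (map_mpoly ratr \o map_mpoly intr)) => [a|j] /=.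
      by rewrite !map_mpolyC /= ratr_int.
    by rewrite !map_mpolyX.
  by rewrite HE map_mpolyZ mevalZ hx0 mulr0.
- exists [seq Posz a | a <- s]; first by rewrite size_map.
  rewrite -(intr_eq0 rat) evH mulf_neq0 ?intr_eq0 //.
  move: hs; rewrite /seqeval; congr (_ != _); apply: meval_eq => j.
  by rewrite !(nth_map 0%N) ?ss.
- move=> x y xy; apply/eqP; rewrite -(eqr_int rat) !evH; apply/eqP; congr (_ * _).
  by apply: hx => j /xy ->.
Qed.

End Elimination.

(** * Counting in boxes *)

Definition ivl (X : nat) : seq int := [seq j%:Z - X%:Z | j <- iota 0 (2 * X)].

Lemma size_ivl X : size (ivl X) = (2 * X)%N.
Proof. by rewrite size_map size_iota. Qed.

Lemma mem_ivl X y : (y \in ivl X) = (- X%:Z <= y < X%:Z).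
Proof.
apply/mapP/idP => [[j]|H]; first by rewrite mem_iota => ? ->; lia.
exists (absz (y + X%:Z)); first by rewrite mem_iota; lia.
lia.
Qed.

(* Points are sequences, so that induction on the number of variables is on the last entry. *)
Fixpoint box (X : nat -> nat) k : seq (seq int) :=
  if k is k'.+1 then [seq rcons x y | x <- box X k', y <- ivl (X k')] else [:: [::]].

Lemma size_mem_box X k x : x \in box X k -> size x = k.
Proof.
elim: k x => [|k IH] x /=; first by rewrite inE => /eqP ->.
by case/allpairsP => -[x' y] /= [/IH sx _ ->]; rewrite size_rcons sx.
Qed.

Lemma mem_box X k x : size x = k ->
  (forall i, (i < k)%N -> - (X i)%:Z <= x`_i < (X i)%:Z) -> x \in box X k.
Proof.
elim: k x => [|k IH] x /=; first by case: x.
case/lastP: x => // x y; rewrite size_rcons => -[sx] H.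
apply/allpairsP; exists (x, y); split=> //=.
  apply: IH => // i ik; have := H i (ltnW ik).
  by rewrite nth_rcons sx ik.
by rewrite mem_ivl; have := H k (leqnn _); rewrite nth_rcons sx ltnn eqxx.
Qed.

Lemma box_bound X k x i : x \in box X k -> (i < k)%N -> (absz (x`_i)%R <= X i)%N.
Proof.
elim: k x => // k IH x /allpairsP[[x' y] /= [xb yb ->]].
rewrite nth_rcons (size_mem_box xb) ltnS leq_eqVlt => /orP[/eqP ->|ik].
  by rewrite ltnn eqxx; move: yb; rewrite mem_ivl; lia.
by rewrite ik; apply: IH.
Qed.

Lemma count_boxS P X k : count P (box X k.+1) =
  (\sum_(x <- box X k) count (fun y => P (rcons x y)) (ivl (X k)))%N.
Proof.
rewrite /= count_flatten sumnE !big_map; apply: eq_bigr => x _.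
by rewrite count_map.
Qed.

Section Counting.
Variable R : realFieldType.

Definition vol (X : nat -> nat) k : R := \prod_(i < k) (2 * X i)%:R.

Lemma vol_ge0 X k : 0 <= vol X k.
Proof. by apply: prodr_ge0. Qed.

Lemma volS X k : vol X k.+1 = vol X k * (2 * X k)%:R.
Proof. by rewrite /vol big_ord_recr. Qed.

Lemma size_box X k : (size (box X k))%:R = vol X k.
Proof.
elim: k => [|k IH]; first by rewrite /vol big_ord0.
by rewrite volS -IH -natrM -size_ivl /= size_allpairs.
Qed.

Lemma count_box_le_vol P X k : (count P (box X k))%:R <= vol X k.
Proof. by rewrite -size_box ler_nat count_size. Qed.

(** Induction step of all box counts, by fibring over the last coordinate: over points of [Q2] the
    whole fibre is given up, over the other points of [Q1] it has density at most [b]. *)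
Lemma count_box_split (P Q1 Q2 : pred (seq int)) X k (b : R) : 0 <= b ->
  (forall x y, x \in box X k -> P (rcons x y) -> Q1 x) ->
  (forall x, x \in box X k -> Q1 x -> ~~ Q2 x ->
     (count (fun y => P (rcons x y)) (ivl (X k)))%:R <= (2 * X k)%:R * b) ->
  (count P (box X k.+1))%:R <=
    (2 * X k)%:R * ((count Q2 (box X k))%:R + (count Q1 (box X k))%:R * b).
Proof.
move=> b0 PQ1 PQ2; have countE (Q : pred (seq int)) : (count Q (box X k))%:R = \sum_(x <- box X k) (Q x)%:R :> R.
  by rewrite -sum1_count big_mkcond natr_sum; apply: eq_bigr => x _; case: (Q x).
rewrite count_boxS natr_sum !countE mulr_suml -big_split /= mulr_sumr.
rewrite big_seq [leRHS]big_seq; apply: ler_sum => x xb.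
have [Q1x|nQ1] := boolP (Q1 x); last first.
  rewrite (eq_count (a2 := pred0)) ?count_pred0 ?mul0r ?mulr_ge0 ?addr_ge0 //.
  by move=> y; apply/negP => /(PQ1 _ _ xb); apply/negP.
have [Q2x|nQ2] := boolP (Q2 x); last by rewrite /= add0r mul1r PQ2.
apply: (@le_trans _ _ (2 * X k)%:R).
  by rewrite ler_nat -size_ivl count_size.
by rewrite ler_peMr // lerDl mul1r.
Qed.

(** A block of p consecutive integers has distinct residues, hence fewer than [size f] roots of the
    nonzero reduction of f; about 2X / p + 1 blocks cover the interval. *)
Lemma count_root_modp (p : nat) (f : {poly int}) j (X : nat) : prime p ->
  ~~ (p%:Z %| f`_j)%Z ->
  (count (fun y => (p%:Z %| f.[y])%Z) (ivl X) <= size f * ((2 * X) %/ p).+1)%N.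
Proof.
move=> pp fj; pose h := map_poly (intr : int -> 'F_p) f.
have dvE z : (p%:Z %| z)%Z = (z%:~R == 0 :> 'F_p) := dvdz_pcharf (pchar_Fp pp) z.
have h0 : h != 0.
  by apply: contraNN fj => /eqP H; rewrite dvE -coef_map -/h H coef0.
have block a m : (m <= p)%N ->
    (count (fun y => (p%:Z %| f.[y])%Z) [seq (j%:Z - X%:Z)%R | j <- iota a m] <= size f)%N.
  move=> mp; rewrite -size_filter; set s := filter _ _.
  have us : uniq [seq (z%:~R : 'F_p) | z <- s].
    rewrite map_inj_in_uniq ?filter_uniq //.
      by rewrite map_inj_uniq ?iota_uniq // => b c /addIr [].
    move=> y z; rewrite !mem_filter => /andP[_ /mapP[b]] + ->.
    rewrite mem_iota => bI /andP[_ /mapP[c]]; rewrite mem_iota => cI -> /eqP.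
    rewrite -subr_eq0 -rmorphB /= -dvE.
    have [->//|ne] := eqVneq b c; rewrite /dvdz /= => /dvdn_leq; lia.
  have := max_poly_roots h0 _ us; rewrite size_map => H.
  apply: ltnW; apply: leq_trans (H _) _; last exact: size_poly.
  apply/allP => _ /mapP[z + ->]; rewrite mem_filter => /andP[+ _].
  by rewrite dvE /root /h horner_map.
have blocks n a m : (m <= n * p)%N ->
    (count (fun y => (p%:Z %| f.[y])%Z) [seq (j%:Z - X%:Z)%R | j <- iota a m] <= size f * n)%N.
  elim: n a m => [|n IH] a m; first by rewrite mul0n leqn0 => /eqP ->; rewrite muln0.
  move=> mn; have [mp|pm] := leqP m p.
    by apply: leq_trans (block _ _ mp) _; rewrite leq_pmulr.
  rewrite -(subnKC (ltnW pm)) iotaD map_cat count_cat mulnS leq_add ?block //.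
  by apply: IH; rewrite mulSn in mn; lia.
apply: blocks; rewrite -ltnS ltnS; apply: ltnW; rewrite mulnC -ltn_divLR ?prime_gt0 //.
Qed.

(** Bounds the density of a residue class modulo p in an interval of length at least M; 1/M pays for
    the incomplete block. *)
Definition inv_sum (p M : nat) : R := p%:R^-1 + M%:R^-1.

Lemma count_root_dens (p M : nat) (f : {poly int}) j (X : nat) : prime p -> (0 < M)%N ->
  (M <= X)%N -> ~~ (p%:Z %| f`_j)%Z ->
  (count (fun y => (p%:Z %| f.[y])%Z) (ivl X))%:R <= (2 * X)%:R * ((size f)%:R * inv_sum p M).
Proof.
move=> pp M0 MX fj; apply: (@le_trans _ _ ((size f)%:R * ((2 * X) %/ p).+1%:R)).
  by rewrite -natrM ler_nat (count_root_modp _ pp fj).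
rewrite mulrCA ler_wpM2l // /inv_sum mulrDr -addn1 natrD lerD //.
  by rewrite ler_pdivlMr ?ltr0n ?prime_gt0 // -natrM ler_nat leq_trunc_div.
by rewrite ler_pdivlMr ?ltr0n // mul1r ler_nat; lia.
Qed.

End Counting.

(** * The geometric sieve *)

Lemma expn_size_primes b (s : seq nat) n : uniq s -> (0 < n)%N ->
  (forall p, p \in s -> [&& prime p, (b <= p)%N & (p %| n)%N]) -> (b ^ size s <= n)%N.
Proof.
elim: s n => [|p s IH] n //= /andP[ps us] n0 H.
have /and3P[pp bp /dvdnP[m nE]] := H p (mem_head _ _).
have m0 : (0 < m)%N by move: n0; rewrite nE muln_gt0 => /andP[].
rewrite expnS nE mulnC leq_mul //; apply: IH => // l ls.
have /and3P[pl bl] : [&& prime l, (b <= l)%N & (l %| n)%N] by apply: H; rewrite inE ls orbT.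
rewrite pl bl nE Gauss_dvdl // prime_coprime // dvdn_prime2 //.
by apply: contraNN ps => /eqP <-.
Qed.

(** Polynomial growth on the logarithmic scale. With [expn_size_primes] it leaves only O(L + 1)
    prime divisors of a nonzero value. *)
Lemma seqeval_bound k (h : {mpoly int[k]}) : exists C : nat, forall (L : nat) (x : seq int),
  (forall i, (i < k)%N -> `|x`_i| <= 2 ^+ L) -> `|seqeval x h| <= 2 ^+ (C * L.+1).
Proof.
elim/mpolyind: h => [|c m p _ _ [C HC]].
  by exists 0%N => L x _; rewrite rmorph0 normr0 exprn_ge0.
exists (absz c + \sum_(i < k) m i + C).+1%N => L x xL.
have le1 : `|c| <= 2 ^+ (absz c * L.+1).
  rewrite -abszE -[2]/(2%:R) -natrX natz lez_nat.
  by apply: leq_trans (ltnW (ltn_expl _ (ltnSn 1))) _; rewrite leq_exp2l // mulnS leq_addr.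
have le2 : `|\prod_(i < k) x`_i ^+ m i| <= 2 ^+ ((\sum_(i < k) m i) * L.+1).
  rewrite normr_prod big_distrl /= -prodrXr.
  apply: ler_prod => i _; rewrite normr_ge0 normrX /= mulnC exprM lerXn2r ?nnegrE ?exprn_ge0 //.
  by apply: le_trans (xL i (ltn_ord i)) _; rewrite ler_weXn2l.
have le3 := HC L x xL.
rewrite /seqeval mevalD mevalZ mevalX; apply: le_trans (ler_normD _ _) _.
rewrite mulSn exprD; set e := (_ * _)%N.
have two : 2 <= 2 ^+ L.+1 :> int by rewrite ler_eXnr.
apply: (@le_trans _ _ (2 * 2 ^+ e)); last by rewrite ler_wpM2r ?exprn_ge0.
rewrite mulr_natl mulr2n lerD //.
  rewrite normrM; apply: le_trans (ler_pM _ _ le1 le2) _; rewrite ?normr_ge0 //.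
  by rewrite -exprD ler_weXn2l // /e -mulnDl leq_mul // leq_addr.
by apply: le_trans le3 _; rewrite ler_weXn2l // leq_mul // leq_addl.
Qed.

Section Sieve.
Variable R : realFieldType.
Local Notation vol := (@vol R).
Local Notation dens := (@inv_sum R).

Lemma seqeval_coef_nonzero k (h : {mpoly int[k.+1]}) x : size x = k.+1 -> seqeval x h != 0 ->
  exists j, exists2 s, size s = k & seqeval s (muni h)`_j != 0.
Proof.
case/lastP: x => // s y; rewrite size_rcons => -[ss]; rewrite seqeval_rcons // => H.
have [j Hj] : exists j, (map_poly (seqeval s) (muni h))`_j != 0.
  exists (size (map_poly (seqeval s) (muni h))).-1; rewrite -lead_coefE lead_coef_eq0.
  by apply: contraNN H => /eqP ->; rewrite horner0.
by exists j, s => //; rewrite -coef_map.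
Qed.

(** Some coefficient in the last variable is a nonzero polynomial: either it vanishes modulo p at
    the base point, or the fibre has few roots. [p0] is the size of the constant reached when no
    variable is left. *)
Lemma count_zero_modp k (h : {mpoly int[k]}) :
  (exists2 s, size s = k & seqeval s h != 0) ->
  exists C p0 : nat, forall (p M : nat) X, prime p -> (p0 < p)%N -> (0 < M)%N ->
    (forall i, (i < k)%N -> (M <= X i)%N) ->
    (count (fun x => (p%:Z %| seqeval x h)%Z) (box X k))%:R <= C%:R * vol X k * dens p M.
Proof.
elim: k h => [|k IH] h [s ss hs].
  case: s ss hs => // _ h0; exists 0%N, (absz (seqeval [::] h)) => p M X pp p0 _ _ /=.
  rewrite !mul0r addn0 lern0 eqb0; apply/negP; rewrite dvdzE => /dvdn_leq.
  by rewrite absz_gt0 h0 => /(_ isT); rewrite leqNgt p0.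
have [j Hj] := seqeval_coef_nonzero ss hs.
have [C [p0 H]] := IH _ Hj.
exists (C + size (muni h))%N, p0 => p M X pp pp0 M0 XM.
have d0 : 0 <= dens p M by rewrite /inv_sum addr_ge0 ?invr_ge0.
have := @count_box_split R (fun x => (p%:Z %| seqeval x h)%Z) predT
  (fun x => (p%:Z %| seqeval x (muni h)`_j)%Z) X k ((size (muni h))%:R * dens p M).
rewrite mulr_ge0 // => /(_ isT (fun _ _ _ _ => isT)) L.
apply: le_trans (L _) _ => [x xb _ nd|].
  under eq_count => y do rewrite (seqeval_rcons _ _ (size_mem_box xb)).
  rewrite -coef_map in nd.
  apply: le_trans (count_root_dens R pp M0 (XM k _) nd) _ => //.
  by rewrite !ler_wpM2l // ler_wpM2r // ler_nat size_poly.
rewrite count_predT size_box volS natrD.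
have := H p M X pp pp0 M0 (fun i ik => XM i (ltnW ik)).
have X0 : 0 <= (2 * X k)%:R :> R by [].
move=> /(ler_wpM2l X0); have := vol_ge0 R X k; nra.
Qed.

(** A zero is a zero modulo every prime, and for a prime above M the density 1/p + 1/M is at most
    2/M. *)
Lemma count_zero k (h : {mpoly int[k]}) :
  (exists2 s, size s = k & seqeval s h != 0) ->
  exists C : nat, forall (M : nat) X, (0 < M)%N ->
    (forall i, (i < k)%N -> (M <= X i)%N) ->
    (count (fun x => seqeval x h == 0) (box X k))%:R <= C%:R * vol X k / M%:R.
Proof.
move=> /count_zero_modp[C [p0 H]]; exists (2 * C)%N => M X M0 XM.
have [p pM pp] := prime_above (p0 + M).
apply: (@le_trans _ _ (count (fun x => (p%:Z %| seqeval x h)%Z) (box X k))%:R).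
  by rewrite ler_nat; apply: sub_count => x /eqP ->; rewrite dvdz0.
apply: le_trans (H p M X pp _ M0 XM) _; first by lia.
rewrite natrM -!mulrA [X in _ <= X]mulrC -!mulrA ler_wpM2l // ler_wpM2l ?vol_ge0 //.
rewrite /inv_sum mulrC mulr_natl mulr2n lerD // lef_pV2 ?posrE ?ltr0n ?ler_nat //; lia.
Qed.

(* The polynomial H i is nonzero and does not involve the variable i: this is the form in which
   codimension at least two enters the sieve, since it passes to the coefficients with respect to
   the last variable. *)
Definition off_axis k (H : nat -> {mpoly int[k]}) := forall i, (i < k)%N ->
  (exists2 s, size s = k & seqeval s (H i) != 0) /\
  (forall x y : seq int, size x = k -> size y = k ->
     (forall j, j != i -> x`_j = y`_j) -> seqeval x (H i) = seqeval y (H i)).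

(** [H k] is constant in the last variable and descends to [g]; each other [H i] is replaced by one
    of its nonzero coefficients, which still avoids the variable i. *)
Lemma off_axis_descent k (H : nat -> {mpoly int[k.+1]}) : off_axis H ->
  exists (c : nat -> nat) (g : {mpoly int[k]}),
  [/\ off_axis (fun i => (muni (H i))`_(c i)),
      exists2 s, size s = k & seqeval s g != 0
    & forall x y, size x = k -> seqeval (rcons x y) (H k) = seqeval x g].
Proof.
move=> HH.
have Hlast x y : size x = k -> seqeval (rcons x y) (H k) = seqeval x (muni (H k))`_0.
  move=> sx; rewrite (_ : seqeval _ _ = seqeval (rcons x 0) (H k)).
    by rewrite seqeval_rcons // horner_coef0 coef_map.
  apply: (HH k (ltnSn k)).2; rewrite ?size_rcons ?sx // => j jk.
  by rewrite !nth_rcons; case: ltngtP => // E; rewrite E sx eqxx in jk.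
have /choice[c Hc] : forall i, exists j, (i < k)%N ->
    exists2 s, size s = k & seqeval s (muni (H i))`_j != 0.
  move=> i; case: (ltnP i k) => [ik|_]; last by exists 0%N.
  have [[s ss hs] _] := HH i (ltnW ik).
  by have [j Hj] := seqeval_coef_nonzero ss hs; exists j.
exists c, (muni (H k))`_0; split=> //.
- move=> i ik; split; first exact: Hc.
  move=> x y sx sy xy; rewrite -!coef_map.
  (* The two specialisations agree at all natural numbers, hence as polynomials in the last
     variable, hence in each coefficient. *)
  suff -> : map_poly (seqeval x) (muni (H i)) = map_poly (seqeval y) (muni (H i)) by [].
  apply/eqP; rewrite -subr_eq0; apply/negPn/negP => /poly_nat_nonroot[z].
  rewrite hornerD hornerN -!seqeval_rcons // subr_eq0 => /eqP; apply.
  apply: (HH i (ltnW ik)).2; rewrite ?size_rcons ?sx ?sy // => j ji.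
  by rewrite !nth_rcons sx sy; case: ifP => // _; apply: xy.
- have [[s + hs] _] := HH k (ltnSn k); case/lastP: s hs => // s y hs.
  by rewrite size_rcons => -[ss]; exists s; rewrite // -(Hlast s y).
Qed.

End Sieve.

Definition all_dvd k (H : nat -> {mpoly int[k]}) (p : nat) (x : seq int) : bool :=
  all (fun i => (p%:Z %| seqeval x (H i))%Z) (iota 0 k).

Lemma all_dvdP k (H : nat -> {mpoly int[k]}) p x :
  reflect (forall i, (i < k)%N -> (p%:Z %| seqeval x (H i))%Z) (all_dvd H p x).
Proof.
apply: (iffP allP) => A i; first by move=> ik; apply: A; rewrite mem_iota.
by rewrite mem_iota /= add0n; apply: A.
Qed.

Lemma count_has (T U : eqType) (A : U -> pred T) (ps : seq U) (s : seq T) :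
  (count (fun y => has (fun p => A p y) ps) s <= \sum_(p <- ps) count (A p) s)%N.
Proof.
elim: ps => [|p ps IH]; first by rewrite big_nil (eq_count (a2 := pred0)) ?count_pred0.
rewrite big_cons; apply: leq_trans (leq_add (leqnn _) IH).
by rewrite -count_predUI; apply: leq_trans (leq_addr _ _); apply: sub_count => y.
Qed.

Lemma norm_le_exp2 (z : int) n : (`|z| <= 2 ^+ n) = (absz z <= 2 ^ n)%N.
Proof. by rewrite -abszE -[2]/(2%:R) -natrX natz lez_nat. Qed.

Section Sieve.
Variable R : realFieldType.
Local Notation vol := (@vol R).
Local Notation dens := (@inv_sum R).

Lemma dens_ge0 p M : 0 <= dens p M.
Proof. by rewrite /inv_sum addr_ge0 ?invr_ge0. Qed.

Lemma off_axis_const (H : nat -> {mpoly int[1]}) : off_axis H ->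
  exists p0 : nat, forall (p : nat) X x, (p0 < p)%N -> x \in box X 1 -> ~~ all_dvd H p x.
Proof.
move=> /(_ 0%N isT)[[s ss hs] Hc]; exists (absz (seqeval s (H 0%N))) => p X x p0 xb.
apply/all_dvdP => /(_ 0%N isT); rewrite (Hc x s (size_mem_box xb) ss); last first.
  by case=> // j _; rewrite !nth_default ?ss ?(size_mem_box xb).
rewrite dvdzE => /dvdn_leq; rewrite absz_gt0 hs => /(_ isT); lia.
Qed.

(** Which [H i] survives modulo p depends on x; the sum of all sizes bounds its degree in every
    case. *)
Lemma count_fiber k (H : nat -> {mpoly int[k.+1]}) (c : nat -> nat) p M X x :
  prime p -> (0 < M)%N -> (M <= X k)%N -> x \in box X k ->
  ~~ all_dvd (fun i => (muni (H i))`_(c i)) p x ->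
  (count (fun y => all_dvd H p (rcons x y)) (ivl (X k)))%:R <=
  (2 * X k)%:R * ((\sum_(i < k) size (muni (H i)))%:R * dens p M).
Proof.
move=> pp M0 MX xb; rewrite /all_dvd -has_predC => /hasP[i]; rewrite mem_iota add0n /= => ik nd.
rewrite -coef_map in nd.
apply: (@le_trans _ _ (count (fun y => (p%:Z %| seqeval (rcons x y) (H i))%Z) (ivl (X k)))%:R).
  rewrite ler_nat; apply: sub_count => y Hy; have /all_dvdP := Hy : all_dvd H p (rcons x y).
  by apply; apply: ltnW.
under eq_count => y do rewrite (seqeval_rcons _ _ (size_mem_box xb)).
apply: le_trans (count_root_dens R pp M0 MX nd) _.
rewrite !ler_wpM2l // ler_wpM2r ?dens_ge0 // ler_nat.
apply: leq_trans (size_poly _ _) _.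
by rewrite (bigD1 (Ordinal ik)) //= leq_addr.
Qed.

(** The square has two sources: either all chosen coefficients vanish modulo p, where induction
    applies, or [g] vanishes modulo p on the base and, in addition, the fibre has few roots. *)
Lemma count_all_modp k (H : nat -> {mpoly int[k.+1]}) : off_axis H ->
  exists C p0 : nat, forall (p M : nat) X, prime p -> (p0 < p)%N -> (0 < M)%N ->
    (forall i, (i < k.+1)%N -> (M <= X i)%N) ->
    (count (all_dvd H p) (box X k.+1))%:R <= C%:R * vol X k.+1 * dens p M ^+ 2.
Proof.
elim: k H => [|k IH] H HH.
  have [p0 Hp0] := off_axis_const HH; exists 0%N, p0 => p M X pp pp0 _ _.
  rewrite !mul0r lern0 -leqn0 leqNgt -has_count; apply/hasPn => x; exact: Hp0.
have [c [g [Hc g0 Hg]]] := off_axis_descent HH.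
have [C1 [p1 H1]] := IH _ Hc; have [C2 [p2 H2]] := count_zero_modp R g0.
pose D := (\sum_(i < k.+1) size (muni (H i)))%N.
exists (C1 + C2 * D)%N, (p1 + p2)%N => p M X pp pp0 M0 XM.
have XM' i : (i < k.+1)%N -> (M <= X i)%N by move=> ik; apply: XM; apply: ltnW.
have := @count_box_split R (all_dvd H p) (fun x => (p%:Z %| seqeval x g)%Z)
  (all_dvd (fun i => (muni (H i))`_(c i)) p) X k.+1 (D%:R * dens p M).
rewrite mulr_ge0 ?dens_ge0 // => /(_ isT) L.
apply: le_trans (L _ _) _ => [x y xb /all_dvdP/(_ k.+1 (ltnSn _))|x xb _ nd|].
- by rewrite Hg // (size_mem_box xb).
- exact: count_fiber (XM _ _) xb nd.
rewrite volS; set W := (2 * X k.+1)%:R; rewrite natrD natrM.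
have W0 : 0 <= W by [].
have B1 := H1 p M X pp (leq_ltn_trans (leq_addr _ _) pp0) M0 XM'.
have B2 := H2 p M X pp (leq_ltn_trans (leq_addl _ _) pp0) M0 XM'.
have dD : 0 <= D%:R * dens p M by rewrite mulr_ge0 ?dens_ge0.
have {}B2 := ler_wpM2r dD B2.
apply: le_trans (ler_wpM2l W0 (lerD B1 B2)) _; rewrite le_eqVlt; apply/orP; left.
by apply/eqP; ring.
Qed.

(* H_k does not involve the last variable, so outside its small zero set a point x of the base has
   only O(L) primes p dividing H_k(x); for each of them the fibre has few points unless all
   coefficients vanish mod p, which is the induction hypothesis. *)
Lemma count_all_large k (H : nat -> {mpoly int[k.+1]}) : off_axis H ->
  exists C p0 : nat, forall (L M : nat) X, (0 < M)%N ->
    (forall i, (i < k.+1)%N -> (M <= X i <= 2 ^ L)%N) ->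
    (count (fun x => `[< exists p, [/\ prime p, (p0 < p)%N, (M <= p)%N & all_dvd H p x] >])
       (box X k.+1))%:R <= C%:R * vol X k.+1 * L.+1%:R / M%:R.
Proof.
elim: k H => [|k IH] H HH.
  have [p0 Hp0] := off_axis_const HH; exists 0%N, p0 => L M X _ _.
  rewrite !mul0r lern0 -leqn0 leqNgt -has_count; apply/hasPn => x xb.
  apply/asboolPn => -[p [_ pp0 _]]; apply/negP; exact: Hp0 xb.
have [c [g [Hc g0 Hg]]] := off_axis_descent HH.
have [C1 [p1 H1]] := IH _ Hc; have [C2 H2] := count_zero R g0.
have [E HE] := seqeval_bound g.
pose D := (\sum_(i < k.+1) size (muni (H i)))%N.
(* At most E (L + 1) primes divide a nonzero value of g, and each leaves fibre density at most 2 D /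
   M, since p >= M. *)
exists (C1 + C2 + 2 * E * D)%N, p1 => L M X M0 XM.
have XM' i : (i < k.+1)%N -> (M <= X i)%N by move=> ik; case/andP: (XM i (ltnW ik)).
set P := fun x => _.
pose Q x := `[< exists p, [/\ prime p, (p1 < p)%N, (M <= p)%N &
   all_dvd (fun i => (muni (H i))`_(c i)) p x] >].
have b0 : 0 <= (E * L.+1)%:R * (D%:R * (2 / M%:R)) :> R by rewrite !mulr_ge0 ?invr_ge0.
have := @count_box_split R P predT (predU Q (fun x => seqeval x g == 0)) X k.+1 _ b0
  (fun _ _ _ _ => isT).
move=> Ls; apply: le_trans (Ls _) _ => [x xb _|].
  rewrite negb_or => /andP[/asboolPn nQ gx0].
  pose ps := [seq p <- primes (absz (seqeval x g)) | (M <= p)%N && (p1 < p)%N].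
  have psP p : p \in ps = [&& (M <= p)%N, (p1 < p)%N, prime p & (p%:Z %| seqeval x g)%Z].
    by rewrite mem_filter mem_primes absz_gt0 gx0 -andbA dvdzE.
  have sps : (size ps <= E * L.+1)%N.
    rewrite -(@leq_exp2l 2) //.
    apply: (@leq_trans (absz (seqeval x g)%R)).
      apply: expn_size_primes; rewrite ?filter_uniq ?primes_uniq ?absz_gt0 //.
      by move=> p; rewrite psP dvdzE => /and4P[_ _ pp ->]; rewrite pp prime_gt1.
    rewrite -norm_le_exp2; apply: HE => i ik; rewrite norm_le_exp2.
    by apply: leq_trans (box_bound xb ik) _; case/andP: (XM i (ltnW ik)).
  have sub : (count (fun y => P (rcons x y)) (ivl (X k.+1)) <=
      \sum_(p <- ps) count (fun y => all_dvd H p (rcons x y)) (ivl (X k.+1)))%N.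
    apply: leq_trans (count_has (fun p y => all_dvd H p (rcons x y)) ps _).
    apply: sub_count => y /asboolP[p [pp p1p Mp ad]]; apply/hasP; exists p => //.
    rewrite psP Mp p1p pp -(Hg x y (size_mem_box xb)).
    by move/all_dvdP: ad => /(_ k.+1 (ltnSn _)).
  apply: (@le_trans _ _ (\sum_(p <- ps) ((2 * X k.+1)%:R * (D%:R * (2 / M%:R))))).
    apply: le_trans (_ : _ <= (\sum_(p <- ps) count (fun y => all_dvd H p (rcons x y)) (ivl (X k.+1)))%:R) _.
      by rewrite ler_nat.
    rewrite natr_sum big_seq [leRHS]big_seq; apply: ler_sum => p.
    rewrite psP => /and4P[Mp p1p pp _].
    have nd : ~~ all_dvd (fun i => (muni (H i))`_(c i)) p x.
      by apply/negP => ad; apply: nQ; exists p.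
    have [MX _] := andP (XM k.+1 (ltnSn _)).
    apply: le_trans (count_fiber pp M0 MX xb nd) _.
    have dM : dens p M <= 2 / M%:R.
      rewrite /inv_sum mulr_natl mulr2n lerD2r.
      by rewrite lef_pV2 ?posrE ?ltr0n ?ler_nat ?(prime_gt0 pp).
    by rewrite ler_wpM2l // ler_wpM2l.
  rewrite big_const_seq count_predT iter_addr_0 -[_ *+ size ps]mulr_natl mulrCA.
  by rewrite ler_wpM2l // ler_wpM2r ?ler_nat // !mulr_ge0 ?invr_ge0.
rewrite count_predT size_box [vol X k.+2]volS; set W := (2 * X k.+1)%:R; rewrite !natrD !natrM.
have W0 : 0 <= W by [].
have B1 := H1 L M X M0 (fun i ik => XM i (ltnW ik)).
have B2 := H2 M X M0 XM'.
have cU : (count (predU Q (fun x => seqeval x g == 0)) (box X k.+1))%:R <=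
   C1%:R * vol X k.+1 * L.+1%:R / M%:R + C2%:R * vol X k.+1 * L.+1%:R / M%:R.
  apply: le_trans (_ : _ <= (count Q (box X k.+1) + count (fun x => seqeval x g == 0) (box X k.+1))%:R) _.
    by rewrite ler_nat -count_predUI leq_addr.
  rewrite natrD lerD //; apply: le_trans B2 _; rewrite ler_wpM2r ?invr_ge0 //.
  by rewrite ler_peMr ?mulr_ge0 ?vol_ge0 // ler1n.
apply: le_trans (ler_wpM2l W0 (lerD cU (lexx _))) _; rewrite le_eqVlt; apply/orP; left.
move: (M%:R^-1) (vol X k.+1) (L.+1%:R) => m V l; apply/eqP; ring.
Qed.

Lemma box_sieve k (H : nat -> {mpoly int[k.+1]}) : off_axis H ->
  exists C p0 : nat, forall (L M N : nat) X, (0 < M)%N -> (p0 < N)%N ->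
    (forall i, (i < k.+1)%N -> (M <= X i <= 2 ^ L)%N) ->
    (count (fun x => `[< exists p, [/\ prime p, (N <= p)%N & all_dvd H p x] >])
       (box X k.+1))%:R <=
    C%:R * vol X k.+1 * (\sum_(N <= p < M | prime p) (p%:R ^- 2) + L.+1%:R / M%:R).
Proof.
move=> HH; have [C1 [p1 H1]] := count_all_modp HH; have [C2 [p2 H2]] := count_all_large HH.
(* The 4 comes from 1/p + 1/M <= 2/p for p < M, squared. *)
exists (4 * C1 + C2)%N, (p1 + p2)%N => L M N X M0 Np XM.
have XM' i : (i < k.+1)%N -> (M <= X i)%N by move=> /XM/andP[].
pose ps := [seq p <- index_iota N M | prime p].
set P := fun x => _.
pose Q x := `[< exists p, [/\ prime p, (p2 < p)%N, (M <= p)%N & all_dvd H p x] >].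
have cP : (count P (box X k.+1) <= \sum_(p <- ps) count (all_dvd H p) (box X k.+1)
    + count Q (box X k.+1))%N.
  apply: leq_trans (leq_add (count_has (fun p => all_dvd H p) ps (box X k.+1)) (leqnn _)).
  rewrite -count_predUI; apply: leq_trans (leq_addr _ _); apply: sub_count => x.
  move=> /asboolP[p [pp Np' ad]] /=; case: (ltnP p M) => [pM|Mp]; apply/orP.
    by left; apply/hasP; exists p; rewrite // mem_filter pp mem_index_iota Np'.
  right; apply/asboolP; exists p; split=> //; lia.
apply: le_trans (_ : _ <= (\sum_(p <- ps) count (all_dvd H p) (box X k.+1)
    + count Q (box X k.+1))%:R) _; first by rewrite ler_nat.
rewrite natrD mulrDr; apply: lerD.
  rewrite natr_sum /ps big_filter mulr_sumr big_nat_cond [leRHS]big_nat_cond.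
  apply: ler_sum => p /andP[/andP[Np' pM] pp].
  have pp1 : (p1 < p)%N by lia.
  apply: le_trans (H1 p M X pp pp1 M0 XM') _.
  have dp : dens p M <= 2 * p%:R^-1.
    rewrite /inv_sum mulr_natl mulr2n lerD2l lef_pV2 ?posrE ?ltr0n ?ler_nat ?(prime_gt0 pp) //.
    exact: ltnW.
  have d2 : dens p M ^+ 2 <= 4 * p%:R ^- 2.
    rewrite (_ : 4 * _ = (2 * p%:R^-1) ^+ 2); last by rewrite exprMn exprVn; ring.
    by rewrite lerXn2r ?nnegrE ?dens_ge0 // mulr_ge0 ?invr_ge0.
  apply: le_trans (ler_wpM2l _ d2) _; first by rewrite mulr_ge0 ?vol_ge0.
  rewrite mulrCA !mulrA ler_wpM2r ?invr_ge0 ?exprn_ge0 // ler_wpM2r ?vol_ge0 //.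
  by rewrite -natrM ler_nat leq_addr.
apply: le_trans (H2 L M X M0 XM) _.
rewrite -!mulrA ler_wpM2r //; last by rewrite ler_nat leq_addl.
by rewrite !mulr_ge0 ?vol_ge0 ?invr_ge0.
Qed.

End Sieve.

(** * Chebyshev's bound *)

Lemma prime_dvd_fact p n : prime p -> (p %| n`!)%N -> (p <= n)%N.
Proof.
move=> pp; elim: n => [|n IH]; first by rewrite dvdn1 => /eqP p1; rewrite p1 in pp.
by rewrite factS Euclid_dvdM // => /orP[/dvdn_leq ->|/IH /leqW].
Qed.

Lemma central_bin_le m : ('C(2 * m, m) <= 2 ^ (2 * m))%N.
Proof.
rewrite (_ : (2 ^ (2 * m) = (1 + 1) ^ (2 * m))%N) // Pascal.
have mi : (m < (2 * m).+1)%N by lia.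
by rewrite (bigD1 (Ordinal mi)) //= !exp1n !muln1 leq_addr.
Qed.

(** The primes in (2^j, 2^(j+1)] all divide the central binomial coefficient of 2^(j+1), which is at
    most 2^(2^(j+1)), and each of them exceeds 2^j. *)
Lemma primes_dyadic j :
  (j * size [seq p <- index_iota (2 ^ j).+1 (2 ^ j.+1).+1 | prime p] <= 2 ^ j.+1)%N.
Proof.
rewrite -(@leq_exp2l 2) // expnM.
apply: (@leq_trans 'C(2 * 2 ^ j, 2 ^ j)); last by rewrite [(2 ^ j.+1)%N]expnS central_bin_le.
apply: expn_size_primes; rewrite ?filter_uniq ?iota_uniq //.
  by rewrite bin_gt0 leq_pmull.
move=> p; rewrite mem_filter mem_index_iota => /and3P[pp jp pj].
rewrite pp (ltnW jp) /=.
have : (p %| (2 * 2 ^ j)`!)%N by apply: dvdn_fact; rewrite prime_gt0 // -expnS.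
have := @bin_fact (2 * 2 ^ j) (2 ^ j); rewrite leq_pmull // => /(_ isT) <-.
rewrite mul2n -addnn addnK !Euclid_dvdM // addnn -mul2n.
by case: (boolP (p %| _)%N) => //= _ /orP[] /(prime_dvd_fact pp); rewrite leqNgt jp.
Qed.

(** The primes in (2^J, 2^(J+1)] contribute at most 2 / (J 2^J) <= 2 / (j 2^J), and these bounds
    telescope. *)
Lemma sum_prime_inv_sqr (R : realFieldType) (j N M : nat) : (0 < j)%N -> (2 ^ j < N)%N ->
  \sum_(N <= p < M | prime p) (p%:R ^- 2) <= 4 / (j%:R * 2 ^+ j) :> R.
Proof.
move=> j0 jN.
have jR : 0 < j%:R :> R by rewrite ltr0n.
have two n : 0 < 2 ^+ n :> R by rewrite exprn_gt0.
have step J : (j <= J)%N -> \sum_((2 ^ J).+1 <= p < (2 ^ J.+1).+1 | prime p) (p%:R ^- 2)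
    <= 2 / j%:R / 2 ^+ J :> R.
  move=> jJ; have JR : 0 < J%:R :> R by rewrite ltr0n; lia.
  have := primes_dyadic J; rewrite -(ler_nat R) natrM natrX => H.
  apply: (@le_trans _ _ (\sum_(p <- [seq p <- index_iota (2 ^ J).+1 (2 ^ J.+1).+1 | prime p])
     (2 ^+ J) ^- 2)).
    rewrite big_filter [leLHS]big_nat_cond [leRHS]big_nat_cond; apply: ler_sum => p.
    move=> /andP[/andP[Jp _] _]; rewrite lef_pV2 ?posrE ?exprn_gt0 ?ltr0n //; last by lia.
    by rewrite lerXn2r ?nnegrE ?exprn_ge0 // -natrX ler_nat ltnW.
  rewrite big_const_seq count_predT iter_addr_0 -[_ *+ size _]mulr_natr.
  set n := (size _)%:R in H *.
  have nE : n <= 2 ^+ J.+1 / J%:R by rewrite ler_pdivlMr // mulrC.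
  apply: le_trans (ler_wpM2l _ nE) _; first by rewrite invr_ge0 !exprn_ge0.
  rewrite (_ : (2 ^+ J) ^- 2 * _ = 2 / J%:R / 2 ^+ J).
    rewrite ler_wpM2r ?invr_ge0 ?exprn_ge0 // ler_wpM2l // lef_pV2 ?posrE ?ler_nat //.
  rewrite [2 ^+ J.+1]exprS; move: (two J) (J%:R : R) JR; move: (2 ^+ J) => x x0 y y0.
  by field; rewrite !gt_eqF.
have tele d : \sum_((2 ^ j).+1 <= p < (2 ^ (j + d)).+1 | prime p) (p%:R ^- 2)
    <= 4 / j%:R * (2 ^- j - 2 ^- (j + d)) :> R.
  elim: d => [|d IH]; first by rewrite addn0 big_geq // subrr mulr0.
  rewrite (@big_cat_nat _ _ _ (2 ^ (j + d)).+1) /=; last 2 first.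
  - by rewrite ltnS leq_exp2l // leq_addr.
  - by rewrite ltnS leq_exp2l // addnS.
  rewrite addnS; apply: le_trans (lerD IH (step _ (leq_addr _ _))) _.
  rewrite le_eqVlt; apply/orP; left; apply/eqP; rewrite [2 ^+ (j + d).+1]exprS.
  move: (two (j + d)%N) (j%:R : R) jR; move: (2 ^+ (j + d)) (2 ^- j) => x z x0 y y0.
  by field; rewrite !gt_eqF.
have pos p : 0 <= p%:R ^- 2 :> R by rewrite invr_ge0 exprn_ge0.
have le1 : \sum_(N <= p < M | prime p) (p%:R ^- 2) <=
    \sum_((2 ^ j).+1 <= p < (2 ^ (j + M)).+1 | prime p) (p%:R ^- 2) :> R.
  have [NM|MN] := leqP N M; last by rewrite big_geq ?sumr_ge0 // ltnW.
  have M2 : (M <= (2 ^ (j + M)).+1)%N.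
    by apply: leqW; apply: leq_trans (ltnW (ltn_expl M (ltnSn 1))) _; rewrite leq_exp2l ?leq_addl.
  rewrite (@big_cat_nat _ _ _ N _ _ _ _ jN) /=; last exact: leq_trans M2.
  rewrite (@big_cat_nat _ _ _ M _ _ _ _ NM M2) /=.
  by rewrite addrCA lerDl addr_ge0 ?sumr_ge0.
apply: le_trans le1 _; apply: le_trans (tele M) _.
rewrite invfM mulrA ler_wpM2l ?divr_ge0 ?ler0n // lerBlDr lerDl invr_ge0 exprn_ge0 //.
Qed.

(** * Sums over exponent vectors *)

Section ConeSum.
Variables (R : realFieldType) (k L : nat).
Local Notation exps := {ffun 'I_k -> 'I_L.+1}.

Lemma sum_inj_prod (T : {set exps}) (W : exps -> R) (phi : exps -> exps)
    (w : 'I_k -> 'I_L.+1 -> R) :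
  {in T &, injective phi} -> (forall i j, 0 <= w i j) ->
  (forall a, a \in T -> W a <= \prod_i w i (phi a i)) ->
  \sum_(a in T) W a <= \prod_i \sum_j w i j.
Proof.
move=> inj w0 Ww; apply: le_trans (ler_sum _ Ww) _.
rewrite -(big_imset (fun g : exps => \prod_i w i (g i)) inj) /= bigA_distr_bigA /=.
by rewrite [leLHS]big_mkcond; apply: ler_sum => g _; case: ifP => // _; apply: prodr_ge0.
Qed.

Lemma sum_pow2_le m : \sum_(j < m) 2 ^+ j <= 2 ^+ m :> R.
Proof.
elim: m => [|m IH]; first by rewrite big_ord0 exprn_ge0.
by rewrite big_ord_recr /= exprS mulr_natl mulr2n lerD2r.
Qed.

Lemma sum_pow_half_le m : \sum_(j < m) 2 ^- j <= 2 :> R.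
Proof.
suff : \sum_(j < m) 2 ^- j <= 2 - 2 ^- m *+ 2 :> R.
  by move=> H; apply: le_trans H _; rewrite lerBlDr lerDl mulrn_wge0 // invr_ge0 exprn_ge0.
elim: m => [|m IH]; first by rewrite big_ord0 expr0 invr1 subrr.
rewrite big_ord_recr /= exprS invfM; move: (2 ^- m) IH => x IH; lra.
Qed.

Variables (sg : {set 'I_k}) (e : 'I_k -> nat) (A : 'I_k -> 'I_k -> int).
Hypothesis e_sg : forall i, i \in sg -> e i = 0%N.
Hypothesis A_sg : forall i j, i \in sg -> j \in sg -> A i j = - (i == j)%:R.

(** In the application A i j = - <u_i, v_j> with u the dual basis of the cone, so these are the
    coordinates of - sum_j a_j v_j. With e_j = <m, v_j> + 1 for the vertex m of the cone, the last
    clause of [cone_adm] is the pairing of that vector with m. *)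
Definition cone_coord (a : 'I_k -> nat) i : int := \sum_j (a j)%:Z * A i j.
Definition cone_height (a : 'I_k -> nat) : nat := (\sum_j a j * e j)%N.
Definition cone_adm (a : 'I_k -> nat) : Prop :=
  [/\ forall i, i \in sg -> 0 <= cone_coord a i, (cone_height a <= L)%N
    & (\sum_j a j)%:Z + \sum_(i in sg) cone_coord a i = cone_height a].

Definition nat_exps (a : exps) : 'I_k -> nat := fun i => a i.
Local Notation "a ^n" := (nat_exps a) (at level 2, format "a ^n").

(* On a cone, sum a = height a - sum of the coordinates c_i, so 2^(sum a) = 2^height * prod 2^(-c_i).
   The new coordinates of a are: its height in place of a_i1, the c_i on the cone, and a_i elsewhere,
   except on Z, where the remaining hypotheses must determine a_i. *)
Lemma cone_sum_le (T : {set exps}) (i1 : 'I_k) (Z : {set 'I_k}) :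
  i1 \notin sg -> i1 \notin Z -> [disjoint Z & sg] ->
  (forall a, a \in T -> cone_adm a^n) ->
  (forall a b, a \in T -> b \in T -> cone_height a^n = cone_height b^n ->
     (forall i, i \in sg -> cone_coord a^n i = cone_coord b^n i) ->
     (forall i, i \notin sg -> i != i1 -> i \notin Z -> a i = b i) ->
     forall i, i \notin sg -> a i = b i) ->
  (\sum_(a in T) 2 ^+ (\sum_i a i)) * L.+1%:R ^+ #|Z|.+1 <=
    2 ^+ #|sg| * 2 ^+ L.+1 * L.+1%:R ^+ (k - #|sg|) :> R.
Proof.
move=> i1s i1Z /pred0P dZ adm inj.
have Zs i : i \in Z -> (i \in sg) = false by move=> iZ; have := dZ i; rewrite /= iZ.
pose phi0 (a : exps) i : nat := if i == i1 then cone_height a^n else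
  if i \in sg then absz (cone_coord a^n i) else if i \in Z then 0%N else a i.
have phiL a i : a \in T -> (phi0 a i < L.+1)%N.
  move=> aT; have [c0 hL E] := adm a aT; rewrite /phi0 ltnS; case: ifP => // _.
  case: ifP => [is_|_]; last by case: ifP => // _; rewrite -ltnS ltn_ord.
  have le_c : cone_coord a^n i <= \sum_(j in sg) cone_coord a^n j.
    by rewrite (bigD1 i) //= lerDl sumr_ge0 // => j /andP[js _]; apply: c0.
  apply: leq_trans hL; rewrite -lez_nat gez0_abs ?c0 // -E.
  by apply: le_trans le_c _; rewrite lerDr.
pose phi (a : exps) : exps := [ffun i => inord (phi0 a i)].
have phiE a i : a \in T -> phi a i = phi0 a i :> nat.
  by move=> aT; rewrite ffunE inordK ?phiL.
pose w i (j : 'I_L.+1) : R := if i == i1 then 2 ^+ j else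
  if i \in sg then 2 ^- j else if i \in Z then (j == ord0)%:R else 1.
have w0 i j : 0 <= w i j.
  by rewrite /w; do 3 ?case: ifP => _ //; rewrite ?invr_ge0 exprn_ge0.
have phi_inj : {in T &, injective phi}.
  move=> a b aT bT ab.
  have E i : phi0 a i = phi0 b i by rewrite -!phiE // ab.
  have hE : cone_height a^n = cone_height b^n by have := E i1; rewrite /phi0 eqxx.
  have cE i : i \in sg -> cone_coord a^n i = cone_coord b^n i.
    move=> is_; have ii1 : (i == i1) = false by apply: contraNF i1s => /eqP <-.
    have := E i; rewrite /phi0 is_ ii1.
    have [/(_ i is_) ca _ _] := adm a aT; have [/(_ i is_) cb _ _] := adm b bT.
    by move=> /(congr1 Posz); rewrite !gez0_abs.
  have off : forall i, i \notin sg -> a i = b i.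
    apply: inj => // i is_ ii1 iZ; have := E i.
    by rewrite /phi0 (negbTE is_) (negbTE ii1) (negbTE iZ) => /val_inj.
  apply/ffunP => i; have [is_|] := boolP (i \in sg); last exact: off.
  have dE (x : exps) : cone_coord x^n i = - (x i)%:Z + \sum_(j | j \notin sg) (x j)%:Z * A i j.
    rewrite /cone_coord (bigID (mem sg)) /=; congr (_ + _).
    rewrite (bigD1 i) //= A_sg // eqxx mulrN1 big1 ?addr0 // => j /andP[js ji].
    by rewrite A_sg // eq_sym (negbTE ji) oppr0 mulr0.
  have := cE i is_; rewrite !dE.
  rewrite (eq_bigr (fun j => (b j)%:Z * A i j)) => [|j js]; last by rewrite off.
  by move=> /addIr/oppr_inj [] /val_inj.
have Ww a : a \in T -> 2 ^+ (\sum_i a i) <= \prod_i w i (phi a i).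
  move=> aT; have [c0 hL E] := adm a aT.
  have -> : \prod_i w i (phi a i) = 2 ^+ cone_height a^n * \prod_(i in sg) 2 ^- absz (cone_coord a^n i).
    rewrite (bigD1 i1) //= /w eqxx (phiE a i1) // /phi0 eqxx; congr (_ * _).
    rewrite [RHS]big_mkcond [RHS](bigD1 i1) //= (negbTE i1s) mul1r.
    apply: eq_bigr => i ii1; rewrite phiE // /phi0 (negbTE ii1).
    have [//|is_] := boolP (i \in sg).
    have [iZ|//] := boolP (i \in Z).
    suff -> : phi a i = ord0 by rewrite eqxx.
    by apply: val_inj; rewrite /= phiE // /phi0 (negbTE ii1) (negbTE is_) iZ.
  rewrite prodfV prodrXr.
  have -> : cone_height a^n = (\sum_i a i + \sum_(i in sg) absz (cone_coord a^n i))%N.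
    apply/eqP; rewrite -eqz_nat -E PoszD; apply/eqP; congr (_ + _).
    rewrite -natz natr_sum; apply: eq_bigr => i is_.
    by rewrite natz gez0_abs // c0.
  by rewrite exprD mulfK // expf_neq0 // pnatr_eq0.
have L0 : 0 <= L.+1%:R :> R by [].
apply: le_trans (ler_wpM2r _ (sum_inj_prod phi_inj w0 Ww)) _; first by rewrite exprn_ge0.
(* The factors L + 1 are handed to i1 and to Z, which have no free exponent of their own; the
   comparison then holds coordinate by coordinate. *)
have -> : L.+1%:R ^+ #|Z|.+1 =
    \prod_i ((if i == i1 then L.+1%:R else 1) * (if i \in Z then L.+1%:R else 1)) :> R.
  by rewrite big_split /= -!big_mkcond big_pred1_eq prodr_const exprS.
have -> : 2 ^+ #|sg| * 2 ^+ L.+1 * L.+1%:R ^+ (k - #|sg|) =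
    \prod_i ((if i == i1 then 2 ^+ L.+1 else 1) * (if i \in sg then 2 else L.+1%:R)) :> R.
  rewrite big_split /= -big_mkcond big_pred1_eq mulrAC mulrC; congr (_ * _).
  rewrite (bigID (mem sg)) /=; congr (_ * _).
    by rewrite -prodr_const; apply: eq_bigr => i ->.
  have -> : (k - #|sg|)%N = #|~: sg| by have := cardsC sg; rewrite card_ord; lia.
  rewrite -prodr_const; apply: eq_big => i; first by rewrite inE.
  by move=> is_; rewrite inE in is_; rewrite (negbTE is_).
rewrite -big_split /=; apply: ler_prod => i _; apply/andP; split.
  by rewrite !mulr_ge0 ?sumr_ge0 //; case: ifP.
rewrite /w; have [->|ii1] := eqVneq i i1.
  rewrite (negbTE i1s) (negbTE i1Z) mulr1 ler_wpM2r //; exact: sum_pow2_le.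
have [is_|is_] := boolP (i \in sg); rewrite ?mul1r.
  rewrite (_ : (i \in Z) = false) ?mulr1; first exact: sum_pow_half_le.
  by apply/negP => iZ; have := Zs _ iZ; rewrite is_.
have [iZ|iZ] := boolP (i \in Z); last by rewrite mulr1 sumr_const card_ord.
by rewrite (bigD1 ord0) //= big1 ?addr0 ?mul1r // => j /negbTE ->.
Qed.

Lemma cone_height_off (a : 'I_k -> nat) :
  (cone_height a)%:Z = \sum_(j | j \notin sg) (a j)%:Z * (e j)%:Z.
Proof.
rewrite /cone_height -natz natr_sum (bigID (mem sg)) /= big1 ?add0r => [|j js].
  by apply: eq_bigr => j _; rewrite natz PoszM.
by rewrite e_sg // muln0.
Qed.

Lemma cone_coord_off (a : 'I_k -> nat) i : i \in sg ->
  \sum_(j | j \notin sg) (a j)%:Z * A i j = cone_coord a i + (a i)%:Z.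
Proof.
move=> is_; have H : \sum_(j in sg) (a j)%:Z * A i j = - (a i)%:Z.
  rewrite (bigD1 i) //= A_sg // eqxx mulrN1 big1 ?addr0 // => j /andP[js ji].
  by rewrite A_sg // eq_sym (negbTE ji) oppr0 mulr0.
by rewrite /cone_coord [in RHS](bigID (mem sg)) /= H addrAC addNr add0r.
Qed.

(** As e_i1 > 0, the height and the other exponents off the cone determine a_i1, so [Z] is empty. *)
Lemma cone_sum_all (T : {set exps}) (i1 : 'I_k) :
  i1 \notin sg -> (0 < e i1)%N -> (forall a, a \in T -> cone_adm a^n) ->
  (\sum_(a in T) 2 ^+ (\sum_i a i)) * L.+1%:R <=
    2 ^+ #|sg| * 2 ^+ L.+1 * L.+1%:R ^+ (k - #|sg|) :> R.
Proof.
move=> i1s e1 adm.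
have := @cone_sum_le T i1 set0 i1s _ _ adm; rewrite cards0 expr1; apply.
- by rewrite inE.
- by apply/pred0P => i; rewrite /= inE.
move=> a b aT bT hE _ off i is_.
have [->|ii1] := eqVneq i i1; last by apply: off => //; rewrite inE.
have := congr1 Posz hE; rewrite !cone_height_off !(bigD1 i1 i1s) /=.
rewrite [X in _ + X = _](eq_bigr (fun j => (b j)%:Z * (e j)%:Z)) => [/addIr H|j /andP[js j1]].
  have e1Z : (e i1)%:Z != 0 by rewrite eqz_nat -lt0n.
  by have [] := mulIf e1Z H => /val_inj.
by rewrite /nat_exps off // inE.
Qed.

(* Fixing a_i0 = al is a second linear equation with coefficients q outside the cone. If q and e are
   not proportional there, it removes one more free exponent; if they are proportional, it forces
   e_i1 * sum a <= (e_i1 - 1) L + O(al), which saves a power of 2^L. *)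
Lemma cone_sum_fixed (T : {set exps}) (i0 i1 : 'I_k) (al l : nat) (q : 'I_k -> int) :
  i1 \notin sg -> (0 < e i1)%N -> (forall a, a \in T -> cone_adm a^n) ->
  (forall a, a \in T -> a i0 = al :> nat) ->
  (if i0 \in sg then forall j, j \notin sg -> q j = A i0 j
   else forall j, j \notin sg -> q j = (j == i0)%:R) ->
  (exists2 j, j \notin sg & q j != 0) ->
  (L < 2 ^ l)%N -> (e i1 * e i1 * al + e i1 * (l * k.+2) <= L)%N ->
  (\sum_(a in T) 2 ^+ (\sum_i a i)) * L.+1%:R ^+ 2 <=
    2 ^+ #|sg| * 2 ^+ L.+1 * L.+1%:R ^+ (k - #|sg|) :> R.
Proof.
move=> i1s e1 adm Tal qE [j0 j0s qj0] Ll EL.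
have qsum (a : exps) : a \in T -> \sum_(j | j \notin sg) (a j)%:Z * q j =
    al%:Z + (if i0 \in sg then cone_coord a^n i0 else 0).
  move=> aT; rewrite -(Tal a aT); case: ifP qE => i0s qE.
    rewrite addrC -(cone_coord_off a^n i0s); apply: eq_bigr => j js; by rewrite qE.
  rewrite (bigD1 i0) /= ?i0s // qE ?i0s // eqxx mulr1 big1 // => j /andP[js ji].
  by rewrite qE // (negbTE ji) mulr0.
(* A nonzero 2 x 2 minor of (e, q) at i1 and i2 recovers a_i1 and a_i2 from the two equations, which
   allows [Z] to be {i2}. *)
case: (boolP [exists i2 : 'I_k, (i2 \notin sg) && ((e i1)%:Z * q i2 != (e i2)%:Z * q i1)]).
  move=> /existsP[i2 /andP[i2s det]].
  have i12 : i2 != i1 by apply: contraNneq det => ->.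
  have := @cone_sum_le T i1 [set i2] i1s _ _ adm; rewrite cards1; apply.
  - by rewrite inE eq_sym.
  - by apply/pred0P => i /=; rewrite inE; case: eqP => // ->; rewrite (negbTE i2s).
  move=> a b aT bT hE cE off.
  have two (f : 'I_k -> int) : \sum_(j | j \notin sg) (a j)%:Z * f j = \sum_(j | j \notin sg) (b j)%:Z * f j ->
      ((a i1)%:Z - (b i1)%:Z) * f i1 + ((a i2)%:Z - (b i2)%:Z) * f i2 = 0.
    have i2c : (i2 \notin sg) && (i2 != i1) by rewrite i2s.
    rewrite !(bigD1 i1 i1s) /= !(bigD1 i2 i2c) /=.
    rewrite [X in _ + (_ + X) = _](eq_bigr (fun j => (b j)%:Z * f j)) => [|j /andP[/andP[js j1] j2]].
      move: (\sum_(_ | _) _) => S; lia.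
    by rewrite off // inE.
  have t1 := two (fun j => (e j)%:Z); rewrite -!(cone_height_off _^n) in t1.
  have {}t1 := t1 (congr1 Posz hE).
  have t2 := two q; rewrite !qsum // in t2.
  have {}t2 : ((a i1)%:Z - (b i1)%:Z) * q i1 + ((a i2)%:Z - (b i2)%:Z) * q i2 = 0.
    by apply: t2; case: ifP => // i0s; rewrite cE.
  have d2 : (a i2)%:Z - (b i2)%:Z = 0.
    have /eqP : ((a i2)%:Z - (b i2)%:Z) * ((e i1)%:Z * q i2 - (e i2)%:Z * q i1) = 0.
      rewrite [LHS](_ : _ = (e i1)%:Z * (((a i1)%:Z - (b i1)%:Z) * q i1 + ((a i2)%:Z - (b i2)%:Z) * q i2)
        - q i1 * (((a i1)%:Z - (b i1)%:Z) * (e i1)%:Z + ((a i2)%:Z - (b i2)%:Z) * (e i2)%:Z)); last by ring.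
      by rewrite t1 t2 !mulr0 subrr.
    by rewrite mulf_eq0 [X in _ || X]subr_eq0 (negbTE det) orbF => /eqP.
  have d1 : (a i1)%:Z - (b i1)%:Z = 0.
    move: t1; rewrite d2 mul0r addr0 => /eqP; rewrite mulf_eq0 => /orP[/eqP //|].
    by rewrite eqz_nat; case: (e i1) e1.
  move=> i is_; have [->|ii1] := eqVneq i i1.
    by apply: val_inj; apply/eqP; rewrite -eqz_nat -subr_eq0 d1.
  have [->|ii2] := eqVneq i i2; first by apply: val_inj; apply/eqP; rewrite -eqz_nat -subr_eq0 d2.
  by apply: off => //; rewrite inE.
move=> /existsPn Hdeg.
have deg j : j \notin sg -> (e i1)%:Z * q j = (e j)%:Z * q i1.
  by move=> js; have := Hdeg j; rewrite js /= negbK => /eqP.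
have q1 : q i1 != 0.
  apply: contraNneq qj0 => q1; have := deg j0 j0s; rewrite q1 mulr0 => /eqP.
  by rewrite mulf_eq0 eqz_nat; case: (e i1) e1.
(* Since L + 1 <= 2^l, the slack l (k + 2) pays (L + 1)^k for the number of exponent vectors and (L
   + 1)^2 for the factor in the claim. *)
have key (a : exps) : a \in T -> (\sum_i a i + l * k.+2 <= L)%N.
  move=> aT; have [c0 hL E] := adm a aT.
  have H : q i1 * (cone_height a^n)%:Z = (e i1)%:Z * (al%:Z + (if i0 \in sg then cone_coord a^n i0 else 0)).
    rewrite -qsum // cone_height_off !mulr_sumr; apply: eq_bigr => j js.
    by rewrite [RHS]mulrCA deg // /nat_exps; ring.
  have S0 (P : pred 'I_k) : (forall j, P j -> j \in sg) -> 0 <= \sum_(j | P j) cone_coord a^n j.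
    by move=> Ps; apply: sumr_ge0 => j /Ps; apply: c0.
  have [c [c_ge cS cH]] : exists c : int, [/\ 0 <= c, c <= \sum_(i in sg) cone_coord a^n i &
      q i1 * (cone_height a^n)%:Z = (e i1)%:Z * (al%:Z + c)].
    move: H; case: ifP => i0s H; last by exists 0; split=> //; apply: S0.
    exists (cone_coord a^n i0); split=> //; first exact: c0.
    by rewrite (bigD1 i0) //= lerDl; apply: S0 => j /andP[].
  have Ea : (\sum_j a j)%:Z + c <= cone_height a^n by rewrite -E lerD2l.
  (* If q_i1 >= 1, then h <= e_i1 (al + c), which is combined with sum a + c <= h <= L; if q_i1 <=
     -1, the sign forces h = 0. *)
  have eh : (e i1 * (\sum_j a j) <= (e i1).-1 * L + e i1 * e i1 * al)%N.
    move: cH Ea c_ge e1 hL q1; move: (\sum_j _)%N (cone_height _) (q i1) (e i1) => S h x [|y] //=.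
    move=> cH Ea c_ge _ hL x0.
    have [x1|x1] : x <= -1 \/ 1 <= x by lia.
      have h0 : h = 0%N by nia.
      have : S = 0%N by lia.
      by move=> ->; rewrite muln0.
    have h1 : h%:Z <= y.+1%:Z * (al%:Z + c) by nia.
    rewrite -lez_nat PoszD !PoszM; nia.
  have e1Z : (e i1 * (\sum_j a j + l * k.+2) <= e i1 * L)%N.
    rewrite mulnDr; case: (e i1) e1 eh EL => // y _ /= eh EL; lia.
  by move: e1Z; rewrite leq_pmul2l.
have R1 : 1 <= L.+1%:R :> R by rewrite ler1n.
have LR : L.+1%:R <= 2 ^+ l :> R by rewrite -natrX ler_nat.
apply: (@le_trans _ _ (2 ^+ L)); last first.
  rewrite exprS -[X in X <= _]mulr1; apply: ler_pM; rewrite ?exprn_ge0 ?ler01 ?exprn_ege1 //.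
  by rewrite mulrA ler_peMl ?exprn_ge0 //; apply: mulr_ege1; rewrite ?exprn_ege1 ?ler1n.
have -> : 2 ^+ L = (2 ^+ l) ^+ k.+2 * 2 ^+ (L - l * k.+2) :> R.
  rewrite -exprM -exprD subnKC //; case: (e i1) e1 EL => // y _; nia.
apply: (@le_trans _ _ (L.+1%:R ^+ k * 2 ^+ (L - l * k.+2) * L.+1%:R ^+ 2)).
  rewrite ler_wpM2r ?exprn_ge0 //.
  apply: le_trans (ler_sum _ (G := fun=> 2 ^+ (L - l * k.+2)) _) _ => [a aT|].
    rewrite ler_weXn2l ?ler1n //; apply: leq_trans (leq_sub2r (l * k.+2) (key a aT)).
    by rewrite addnK.
  rewrite sumr_const -[_ *+ #|T|]mulr_natl ler_wpM2r ?exprn_ge0 // -natrX ler_nat.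
  by apply: leq_trans (max_card _) _; rewrite card_ffun !card_ord.
rewrite mulrAC -exprD addn2 ler_wpM2r ?exprn_ge0 // lerXn2r ?nnegrE ?exprn_ge0 //.
Qed.

End ConeSum.

(** * Cones of the fan and summation over exponent vectors *)

Section Fan.
Variables (n k : nat) (v : 'I_k -> 'I_n -> int) (cones : seq {set 'I_k}).

(** The standard basis is an integral combination of the n rays, so the square matrix of the rays
    has a one-sided inverse, which is two-sided. *)
Lemma dual_basis s : regular_cone v s -> exists u : 'I_k -> 'I_n -> int,
  forall i j, i \in s -> j \in s -> pairing v (u i) j = (i == j)%:R.
Proof.
move=> [sn span].
have /choice[c cE] : forall i : 'I_n, exists c : 'I_k -> int,
    forall i', (i == i')%:R = \sum_(rho in s) c rho * v rho i'.
  by move=> i; apply: span.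
pose g (a : 'I_n) : 'I_k := enum_val (cast_ord (esym sn) a).
have gs a : g a \in s by apply: enum_valP.
have g_sum (f : 'I_k -> int) : \sum_(rho in s) f rho = \sum_a f (g a).
  rewrite big_enum_val /= (reindex (cast_ord (esym sn))) //=.
  by exists (cast_ord sn) => a _; rewrite ?cast_ordK ?cast_ordKV.
pose U := \matrix_(i, a) c i (g a); pose V := \matrix_(a, i) v (g a) i.
have UV : U *m V = 1%:M.
  apply/matrixP => i i'; rewrite !mxE cE g_sum.
  by apply: eq_bigr => a _; rewrite !mxE.
have VU := mulmx1C UV.
exists (fun rho i => c i rho) => i j is_ js.
have gK rho : rho \in s -> exists a, g a = rho.
  move=> rs; exists (cast_ord sn (enum_rank_in rs rho)).
  by rewrite /g cast_ordK enum_rankK_in.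
have [a <-] := gK i is_; have [b <-] := gK j js.
have /matrixP/(_ b a) := VU; rewrite !mxE => H.
rewrite /pairing (inj_eq enum_val_inj) (inj_eq (@cast_ord_inj _ _ _)) eq_sym -H.
by apply: eq_bigr => i' _; rewrite !mxE mulrC.
Qed.

Lemma in_cone_pairing s (w : 'I_n -> rat) : in_cone v s w ->
  exists c : 'I_k -> rat, (forall rho, 0 <= c rho) /\ forall m : 'I_n -> int,
    \sum_i (m i)%:~R * w i = \sum_(rho in s) c rho * (pairing v m rho)%:~R.
Proof.
move=> [c [c0 wE]]; exists c; split=> // m.
under eq_bigr => i _ do rewrite wE mulr_sumr.
rewrite exchange_big; apply: eq_bigr => rho _.
rewrite /pairing rmorph_sum mulr_sumr; apply: eq_bigr => i _.
by rewrite rmorphM /= mulrCA.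
Qed.

Hypothesis fan : complete_regular_fan v cones.
Hypothesis gg : anticanonical_gg v cones.

(** By completeness the opposite of a ray lies in a cone. Hence a linear form positive on one ray is
    negative on another, and conversely. *)
Lemma opp_ray_pairing rho0 : exists (t : {set 'I_k}) (c : 'I_k -> rat),
  (forall rho, 0 <= c rho) /\ forall m : 'I_n -> int,
    - (pairing v m rho0)%:~R = \sum_(rho in t) c rho * (pairing v m rho)%:~R.
Proof.
have [_ _ _ cplt] := fan.
have [t _ /in_cone_pairing[c [c0 H]]] := cplt (fun i => - (v rho0 i)%:~R).
exists t, c; split=> // m; rewrite -H /pairing rmorph_sum -sumrN.
by apply: eq_bigr => i _; rewrite rmorphM mulrN.
Qed.

(** Here m is the vertex of the anticanonical polytope at s. Without i1, m would be -1 on every ray;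
    without j, the dual form u_i would be nonnegative on every ray and 1 on v_i. Completeness
    excludes both. *)
Lemma cone_data s : s \in cones -> (0 < n)%N ->
  exists (m : 'I_n -> int) (e : 'I_k -> nat) (A : 'I_k -> 'I_k -> int),
  [/\ in_antican_polytope v m, forall rho, pairing v m rho + 1 = e rho,
      forall i, i \in s -> e i = 0%N,
      forall i j, i \in s -> j \in s -> A i j = - (i == j)%:R &
  [/\ exists2 i1, i1 \notin s & (0 < e i1)%N,
      forall i, i \in s -> exists2 j, j \notin s & A i j != 0 &
      forall a : 'I_k -> nat,
        in_cone v s (fun i => - \sum_rho (a rho)%:R * (v rho i)%:~R) ->
        (forall i, i \in s -> 0 <= cone_coord A a i) /\
        (\sum_j a j)%:Z + \sum_(i in s) cone_coord A a i = cone_height e a]].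
Proof.
move=> s_in n0; have [reg _ _ _] := fan.
have [u uE] := dual_basis (reg s s_in).
have [m [ms mP]] := gg s_in.
have [sn _] := reg s s_in.
have [e eE] : exists e : 'I_k -> nat, forall rho, pairing v m rho + 1 = e rho.
  exists (fun rho => absz (pairing v m rho + 1)) => rho.
  by rewrite gez0_abs // -lerBlDr sub0r mP.
have e_s i : i \in s -> e i = 0%N.
  by move=> is_; apply/eqP; rewrite -eqz_nat -eE ms.
exists m, e, (fun i j => - pairing v (u i) j); split=> //.
  by move=> i j is_ js; rewrite uE.
split.
- have [rho0 r0] : exists rho, rho \in s by apply/card_gt0P; rewrite sn.
  apply: contrapT => N; have [t [c [c0 H]]] := opp_ray_pairing rho0.
  have all1 rho : pairing v m rho = -1.
    have [/ms//|rs] := boolP (rho \in s).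
    have : e rho = 0%N by apply/eqP; rewrite -leqn0 leqNgt; apply/negP => ?; apply: N; exists rho.
    by move=> e0; have := eE rho; rewrite e0; lia.
  have := H m; rewrite all1 opprK => /eqP; apply/negP; rewrite gt_eqF //.
  apply: le_lt_trans (_ : _ <= 0) _ => //; apply: sumr_le0 => rho _.
  by rewrite all1 mulrN1 oppr_le0.
- move=> i is_; apply: contrapT => N; have [t [c [c0 H]]] := opp_ray_pairing i.
  have ge0 j : 0 <= pairing v (u i) j.
    have [js|js] := boolP (j \in s); first by rewrite uE.
    apply: contrapT => neg; apply: N; exists j => //; rewrite oppr_eq0.
    by apply: contra_notN neg => /eqP ->.
  have := H (u i); rewrite uE // eqxx => /eqP; apply/negP; rewrite lt_eqF //.
  apply: lt_le_trans (_ : 0 <= _) => //; apply: sumr_ge0 => rho _.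
  by rewrite mulr_ge0 // ler0z.
move=> a /in_cone_pairing[c [c0 H]].
have HE (m' : 'I_n -> int) : - (\sum_rho (a rho)%:Z * pairing v m' rho)%:~R =
    \sum_(rho in s) c rho * (pairing v m' rho)%:~R :> rat.
  rewrite -H rmorph_sum -sumrN.
  under [RHS]eq_bigr => i _ do rewrite mulrN mulr_sumr.
  rewrite [RHS]sumrN [in RHS]exchange_big -[RHS]sumrN; apply: eq_bigr => rho _; congr (- _).
  rewrite rmorphM rmorph_sum mulr_sumr; apply: eq_bigr => i _.
  by rewrite rmorphM /= mulrCA.
have cE i : i \in s -> (cone_coord (fun i j => - pairing v (u i) j) a i)%:~R = c i.
  move=> is_; rewrite (_ : cone_coord _ _ _ = - \sum_rho (a rho)%:Z * pairing v (u i) rho).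
    rewrite rmorphN HE (bigD1 i) //= uE // eqxx mulr1 big1 ?addr0 // => j /andP[js ji].
    by rewrite uE // eq_sym (negbTE ji) mulr0.
  by rewrite /cone_coord -sumrN; apply: eq_bigr => j _; rewrite mulrN.
split=> [i is_|]; first by rewrite -(ler0z rat) cE.
apply/eqP; rewrite -(eqr_int rat) rmorphD /= [X in _ + X == _]rmorph_sum /= (eq_bigr _ cE); apply/eqP.
have := HE m; rewrite [RHS](eq_bigr (fun i => - c i)) => [|i is_]; last by rewrite ms // mulrN1.
rewrite sumrN => /oppr_inj <-; rewrite -rmorphD; congr (_%:~R).
rewrite /cone_height -!natz !natr_sum -big_split; apply: eq_bigr => j _ /=.
by rewrite !natz PoszM -eE mulrDr mulr1 addrC.
Qed.

Lemma rank_pos : (0 < n)%N -> (n < k)%N.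
Proof.
move=> n0; have [reg _ _ cplt] := fan.
have [s s_in _] := cplt (fun=> 0).
have [m [e [A [_ _ _ _ [[i1 i1s _] _ _]]]]] := cone_data s_in n0.
have [sn _] := reg s s_in.
have : (#|s| < #|'I_k|)%N.
  by apply: proper_card; apply/properP; split; [apply/subsetP | exists i1].
by rewrite sn card_ord.
Qed.

(** The height condition on the logarithmic scale: the left side is the base 2 logarithm of the
    anticanonical monomial of m at x_rho = 2^(a_rho). *)
Definition height_le (L : nat) (a : 'I_k -> nat) := forall m, in_antican_polytope v m ->
  \sum_rho (a rho)%:Z * (pairing v m rho + 1) <= L%:Z.

(* For an exponent vector a, the vector - sum_rho a_rho v_rho lies in some cone of the fan, which is
   the chart where the height is read off. *)
Lemma fan_sums (R : realFieldType) : (0 < n)%N -> exists K : nat, forall L,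
  (K * up_log 2 L.+1 <= L)%N -> forall T : {set {ffun 'I_k -> 'I_L.+1}},
  (forall a, a \in T -> height_le L (nat_exps a)) ->
  let bound : R := (size cones)%:R * (2 ^+ n * 2 ^+ L.+1 * L.+1%:R ^+ (k - n)) in
  (\sum_(a in T) 2 ^+ (\sum_i a i)) * L.+1%:R <= bound /\
  forall i0 al, (al <= 2 * up_log 2 L.+1)%N -> (forall a, a \in T -> a i0 = al :> nat) ->
    (\sum_(a in T) 2 ^+ (\sum_i a i)) * L.+1%:R ^+ 2 <= bound.
Proof.
move=> n0; have [reg _ _ cplt] := fan.
pose loc (s : {set 'I_k}) L (T : {set {ffun 'I_k -> 'I_L.+1}}) :=
  [set a in T | `[< in_cone v s (fun i => - \sum_rho (nat_exps a rho)%:R * (v rho i)%:~R) >]].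
pose good K s := forall L, (K * up_log 2 L.+1 <= L)%N ->
  forall T : {set {ffun 'I_k -> 'I_L.+1}}, (forall a, a \in T -> height_le L (nat_exps a)) ->
  let bound : R := 2 ^+ n * 2 ^+ L.+1 * L.+1%:R ^+ (k - n) in
  (\sum_(a in loc s L T) 2 ^+ (\sum_i a i)) * L.+1%:R <= bound /\
  forall i0 al, (al <= 2 * up_log 2 L.+1)%N -> (forall a, a \in T -> a i0 = al :> nat) ->
    (\sum_(a in loc s L T) 2 ^+ (\sum_i a i)) * L.+1%:R ^+ 2 <= bound.
have goodP s : s \in cones -> exists K, good K s.
  move=> s_in; have [m [e [A [mP eE e0 As [[i1 i1s e1] A0 adm]]]]] := cone_data s_in n0.
  have [sn _] := reg s s_in.
  exists (2 * (e i1 * e i1) + e i1 * k.+2)%N => L KL T lowT bound.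
  have admT a : a \in loc s L T -> cone_adm L s e A (nat_exps a).
    rewrite inE => /andP[aT /asboolP /adm[c0 cE]]; split=> //.
    rewrite -lez_nat; apply: le_trans (lowT a aT m mP); rewrite le_eqVlt; apply/orP; left.
    rewrite /cone_height -natz natr_sum; apply/eqP; apply: eq_bigr => j _.
    by rewrite natz eE.
  rewrite /bound -sn; split; first exact: (cone_sum_all (i1 := i1) R e0 As).
  move=> i0 al alL Tal.
  apply: (@cone_sum_fixed R k L s e A e0 As _ i0 i1 al (up_log 2 L.+1)
     (fun j => if i0 \in s then A i0 j else (j == i0)%:R)) => //.
  - by move=> a; rewrite inE => /andP[/Tal].
  - by case: (boolP (i0 \in s)).
  - have [i0s|i0s] := boolP (i0 \in s); first exact: A0.
    by exists i0; rewrite // eqxx.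
  - exact: up_logP.
  - apply: leq_trans KL; rewrite mulnDl leq_add //.
      by rewrite [X in (_ <= X)%N]mulnAC mulnC leq_mul.
    by rewrite -mulnA leq_mul // mulnC.
have [K KP] : exists K, forall s, s \in cones -> good K s.
  have mono K K' s : (K <= K')%N -> good K s -> good K' s.
    move=> KK' H L KL; apply: H; apply: leq_trans KL; exact: leq_mul.
  have : forall s, s \in cones -> exists K, good K s by [].
  elim: (cones) => [|s ss IH] H; first by exists 0%N.
  have [K1 H1] := H s (mem_head _ _).
  have [K2 H2] := IH (fun t ts => H t (mem_behead (s := s :: ss) ts)).
  exists (K1 + K2)%N => t; rewrite inE => /orP[/eqP ->|/H2].
    by apply: mono H1; apply: leq_addr.
  by apply: mono; apply: leq_addl.
exists K => L KL T lowT bound.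
have cover : \sum_(a in T) 2 ^+ (\sum_i a i) <=
    \sum_(s <- cones) \sum_(a in loc s L T) 2 ^+ (\sum_i a i) :> R.
  rewrite (exchange_big_dep (mem T)) /= => [|s a _]; last by rewrite inE => /andP[].
  apply: ler_sum => a aT.
  have [s s_in sa] := cplt (fun i => - \sum_rho (nat_exps a rho)%:R * (v rho i)%:~R).
  rewrite (big_rem s) //= inE aT /= asboolT //= lerDl.
  by apply: sumr_ge0 => *; rewrite exprn_ge0.
have L0 : 0 <= L.+1%:R :> R by [].
have bE : bound = \sum_(s <- cones) (2 ^+ n * 2 ^+ L.+1 * L.+1%:R ^+ (k - n)).
  by rewrite big_const_seq count_predT iter_addr_0 -[_ *+ size _]mulr_natl.
split=> [|i0 al alL Tal].
  apply: le_trans (ler_wpM2r L0 cover) _; rewrite bE mulr_suml.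
  by rewrite big_seq [leRHS]big_seq; apply: ler_sum => s s_in; have [] := KP s s_in L KL T lowT.
apply: le_trans (ler_wpM2r _ cover) _; first by rewrite exprn_ge0.
rewrite bE mulr_suml big_seq [leRHS]big_seq; apply: ler_sum => s s_in.
by have [_ H] := KP s s_in L KL T lowT; apply: H Tal.
Qed.

End Fan.

(** * Heights in Cox coordinates *)

Lemma exprz_sum (F : fieldType) (x : F) (I : Type) (r : seq I) (f : I -> int) :
  x != 0 -> x ^ (\sum_(i <- r) f i) = \prod_(i <- r) x ^ f i.
Proof.
move=> x0; elim: r => [|i r IH]; first by rewrite !big_nil expr0z.
by rewrite !big_cons expfzDr // IH.
Qed.

Section Lift.
Variables (n k : nat) (v : 'I_k -> 'I_n -> int) (cones : seq {set 'I_k}).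
Hypothesis gg : anticanonical_gg v cones.

(** The section chi^m of the anticanonical bundle in Cox coordinates; on the polytope the exponents
    are nonnegative and [absz] changes nothing. *)
Definition anticanonical_monomial (x : 'I_k -> int) (m : 'I_n -> int) : int :=
  \prod_rho x rho ^+ absz (pairing v m rho + 1).

Lemma chi_lift t x m : cox_lift v cones t x ->
  chi m t = \prod_rho ((x rho)%:~R : rat) ^ pairing v m rho.
Proof.
move=> [x0 tE _]; rewrite /chi.
transitivity (\prod_(i < n) \prod_rho (((x rho)%:~R : rat) ^ v rho i) ^ m i).
  apply: eq_bigr => i _; rewrite tE.
  by apply: (big_morph (fun y : rat => y ^ m i) (fun y z => expfzMl y z (m i))); apply: exp1rz.
rewrite exchange_big; apply: eq_bigr => rho _.
rewrite /pairing exprz_sum ?intr_eq0 //; apply: eq_bigr => i _.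
by rewrite exprz_exp mulrC.
Qed.

(* The products x^(<m,rho>+1) are coprime integers proportional to the chi^m(t), by the lifting
   condition on x applied with the vertex m of a cone s avoiding p; so the scaling lambda is an
   integral multiple of theirs. *)
Lemma Htor_le_monomial (R : realType) t x (B : R) m :
  Htor_le v t B -> cox_lift v cones t x -> in_antican_polytope v m ->
  (absz (anticanonical_monomial x m))%:R <= B.
Proof.
move=> [lam [lam0 [lamZ [_ lamB]]]] xt mP; have [x0 tE xp] := xt.
pose mu : rat := \prod_rho (x rho)%:~R.
have xr0 rho : ((x rho)%:~R : rat) != 0 by rewrite intr_eq0.
have mu0 : mu != 0 by apply/prodf_neq0.
have muE m' : in_antican_polytope v m' ->
    mu * chi m' t = (anticanonical_monomial x m')%:~R.
  move=> m'P; rewrite (chi_lift _ xt) -big_split rmorph_prod; apply: eq_bigr => rho _ /=.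
  rewrite -{1}[(x rho)%:~R]expr1z -expfzDr // addrC.
  have : 0 <= pairing v m' rho + 1 by rewrite -lerBlDr sub0r m'P.
  by case: (pairing _ _ _ + 1) => // d _; rewrite rmorphXn.
pose q := lam / mu.
have lamE m' : in_antican_polytope v m' ->
    lam * chi m' t = q * (anticanonical_monomial x m')%:~R.
  by move=> m'P; rewrite -muE // /q mulrA divfK.
have q0 : q != 0 by rewrite mulf_neq0 ?invr_eq0 // gt_eqF.
have den1 : denq q = 1.
  have dq0 : (0 < absz (denq q))%N by rewrite absz_gt0 denq_neq0.
  suff : absz (denq q) = 1%N.
    by move=> H; rewrite -[LHS]gez0_abs ?denq_ge0 // H.
  apply/eqP; rewrite eqn_leq dq0 andbT leqNgt; apply/negP => /pdivP[p pp pq].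
  have [s s_in ps] := xp p pp; have [ms [ms1 msP]] := gg s_in.
  have [z zE] := lamZ ms msP; rewrite lamE // in zE.
  have : (denq q %| numq q * anticanonical_monomial x ms)%Z.
    apply/dvdzP; exists z; apply/eqP; rewrite -(eqr_int rat) !rmorphM /= -zE numqE.
    by rewrite mulrAC.
  rewrite Gauss_dvdzr; last by rewrite coprimez_sym; exact: coprime_num_den.
  move=> /(dvdn_trans pq); rewrite /anticanonical_monomial (big_morph absz abszM absz1).
  rewrite Euclid_dvd_prod // big_has_cond => /hasP[rho _ /=].
  have [rs|rs] := boolP (rho \in s); first by rewrite ms1 // addNr expr0 dvdn1 => /eqP p1; rewrite p1 in pp.
  by rewrite abszX Euclid_dvdX // (negbTE (ps _ rs)).
have qE : q = (numq q)%:~R by rewrite -[LHS]divq_num_den den1 divr1.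
have := lamB m mP; apply: le_trans; rewrite lamE // qE -rmorphM /= -intr_norm ratr_int.
rewrite -[_%:R]/((Posz _)%:~R) ler_int abszE normrM ler_peMl //.
by rewrite -gtz0_ge1 normr_gt0 numq_eq0.
Qed.

Lemma low_lift (R : realType) t x (B : R) L : Htor_le v t B -> cox_lift v cones t x ->
  B < 2 ^+ L.+1 -> height_le v L (fun rho => trunc_log 2 (absz (x rho))).
Proof.
move=> H xt BL m mP; have le1 := Htor_le_monomial H xt mP; have [x0 _ _] := xt.
pose f rho := absz (pairing v m rho + 1).
have fE rho : pairing v m rho + 1 = f rho.
  by rewrite gez0_abs // -lerBlDr sub0r mP.
have -> : \sum_rho (trunc_log 2 (absz (x rho)))%:Z * (pairing v m rho + 1) =
    (\sum_rho trunc_log 2 (absz (x rho)) * f rho)%N.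
  by rewrite -[RHS]natz natr_sum; apply: eq_bigr => rho _; rewrite natz PoszM fE.
rewrite lez_nat -ltnS -(@ltn_exp2l 2) // -(ltr_nat R) natrX [X in _ < X]natrX.
apply: le_lt_trans BL; apply: le_trans le1; rewrite -natrX ler_nat.
rewrite /anticanonical_monomial (big_morph absz abszM absz1) expn_sum.
apply: leq_prod => rho _; rewrite abszX expnM -/(f rho).
have : (2 ^ trunc_log 2 (absz (x rho)) <= absz (x rho))%N.
  by rewrite trunc_logP // absz_gt0.
by case: (f rho) => // d; rewrite leq_exp2r.
Qed.

End Lift.

(** * Dyadic boxes and logarithms *)

Section Dyadic.
Variables (k L : nat).
Local Notation exps := {ffun 'I_k -> 'I_L.+1}.

(** A coordinate of dyadic size a_i satisfies |x_i| < 2^(a_i + 1). Allowing both signs, the interval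
    has length 4 times 2^(a_i), hence the factor 4^k in [vol_side]. *)
Definition side (a : exps) (i : nat) : nat := 2 ^ (if (insub i : option 'I_k) is Some j then a j : nat else 0).+1.

Lemma sideE a (i : 'I_k) : side a i = (2 ^ (a i).+1)%N.
Proof. by rewrite /side valK. Qed.

Lemma vol_side (R : realFieldType) a : vol R (side a) k = 4 ^+ k * 2 ^+ (\sum_i a i).
Proof.
rewrite /vol -prodrXr -[in 4 ^+ k](card_ord k) -prodr_const -big_split.
by apply: eq_bigr => i _ /=; rewrite sideE natrM natrX exprS; ring.
Qed.

Definition log_exps (x : seq int) : exps :=
  [ffun i : 'I_k => inord (trunc_log 2 (absz (nth 0 x i)))].

Lemma size_le_boxes (T : eqType) (s : seq T) (xs : T -> seq int) (P : pred (seq int))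
    (Q : pred exps) : uniq s -> {in s &, injective xs} ->
  (forall t, t \in s -> [/\ size (xs t) = k, P (xs t), Q (log_exps (xs t)) &
     forall i : 'I_k, nth 0 (xs t) i != 0 /\ (trunc_log 2 (absz (nth 0%R (xs t) i)) <= L)%N]) ->
  (size s <= \sum_(a | Q a) count P (box (side a) k))%N.
Proof.
move=> us inj H.
have -> : size s = (\sum_(a | Q a) count (fun t => log_exps (xs t) == a) s)%N.
  under eq_bigr => a _ do rewrite -sum1_count big_mkcond.
  rewrite exchange_big -sum1_size big_seq [RHS]big_seq; apply: eq_bigr => t ts.
  have [_ _ Qt _] := H t ts.
  rewrite (bigD1 (log_exps (xs t))) //= eqxx big1 // => a /andP[_].
  by rewrite eq_sym => /negbTE ->.
apply: leq_sum => a _; rewrite -size_filter -(size_map xs) -[X in (_ <= X)%N]size_filter.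
apply: uniq_leq_size.
  rewrite map_inj_in_uniq ?filter_uniq // => t t'; rewrite !mem_filter => /andP[_ ts] /andP[_ ts'].
  exact: inj.
move=> _ /mapP[t + ->]; rewrite !mem_filter => /andP[/eqP ta ts].
have [sx Px _ xH] := H t ts; rewrite Px /=; apply: mem_box => // i ik.
have [x0 xL] := xH (Ordinal ik).
rewrite -[i]/(val (Ordinal ik)) sideE -ta ffunE inordK //.
have itv (y : int) (b : nat) : (absz y < b)%N -> - b%:Z <= y < b%:Z by lia.
exact/itv/trunc_log_ltn.
Qed.

End Dyadic.

Lemma up_log_small K : exists L0 : nat, forall L, (L0 <= L)%N -> (K * up_log 2 L.+1 <= L)%N.
Proof.
(* Either the logarithm is at most K^2 + K + 1, or 2^l >= (K + 1)(l - K + 1) >= K (l + 1). *)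
exists (K * (K * K + K).+1).+1 => L L0.
have [small|big] := leqP (up_log 2 L.+1) (K * K + K).+1.
  by apply: leq_trans (ltnW L0); rewrite leq_mul.
have := up_log_gtn (isT : 1 < 2)%N (_ : 1 < L.+1)%N; rewrite ltnS => H.
have {}H : (2 ^ (up_log 2 L.+1).-1 <= L)%N by apply: H; lia.
apply: leq_trans H; case: (up_log 2 L.+1) big => // l; rewrite ltnS /= => Kl.
rewrite (_ : l = K + (l - K))%N; last by nia.
rewrite expnD; apply: (@leq_trans (K.+1 * (l - K).+1)); last by rewrite leq_mul // ltn_expl.
nia.
Qed.

Section RealEstimates.
Variable R : realType.

Lemma ln2_ge : 2^-1 <= ln 2 :> R.
Proof.
rewrite -[X in X <= _]expRK ler_ln ?posrE ?expR_gt0 //.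
rewrite -[X in expR X]opprK expRN -[leRHS]invrK lef_pV2 ?posrE ?expR_gt0 ?invr_gt0 //.
by apply: le_trans (expR_ge1Dx _); lra.
Qed.

Lemma ln_le_sub1 (x : R) : 0 < x -> ln x <= x - 1.
Proof. by move=> x0; have := expR_ge1Dx (ln x); rewrite lnK ?posrE //; lra. Qed.

Lemma ln_exp2 m : ln (2 ^+ m) = m%:R * ln 2 :> R.
Proof. by rewrite lnXn // mulr_natl. Qed.

Lemma dyadic_floor (B : R) : 1 <= B -> exists L : nat, 2 ^+ L <= B < 2 ^+ L.+1.
Proof.
move=> B1; exists (trunc_log 2 (Num.truncn B)).
have B0 : 0 <= B by apply: le_trans B1.
have /andP[h1 h2] := truncn_itv B0.
have t0 : (0 < Num.truncn B)%N by rewrite -ltnS -(ltr_nat R); apply: le_lt_trans h2.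
apply/andP; split.
  by apply: le_trans h1; rewrite -natrX ler_nat trunc_logP.
by apply: lt_le_trans h2 _; rewrite -natrX ler_nat trunc_log_ltn.
Qed.

Lemma dyadic_ln (B : R) L : 1 <= ln B -> 0 < B -> 2 ^+ L <= B < 2 ^+ L.+1 ->
  ln B <= L.+1%:R <= 3 * ln B.
Proof.
move=> l1 B0 /andP[LB BL].
have l2 := ln2_ge; have l2' : ln 2 <= 1 :> R by have := @ln_le_sub1 2; lra.
have h1 : ln B <= L.+1%:R * ln 2 by rewrite -ln_exp2 ler_ln ?posrE ?exprn_gt0 // ltW.
have h2 : L%:R * ln 2 <= ln B by rewrite -ln_exp2 ler_ln ?posrE ?exprn_gt0.
have L0 : 0 <= L%:R :> R by [].
rewrite -natr1 in h1 *; apply/andP; split; nra.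
Qed.

Lemma up_log_ln (B : R) L : 1 <= ln (ln B) -> 0 < ln B -> L.+1%:R <= 3 * ln B ->
  (up_log 2 L.+1)%:R <= 7 * ln (ln B).
Proof.
move=> ll lB LB; case: L LB => [|L] LB; first by rewrite up_log1; lra.
have := up_log_gtn (isT : 1 < 2)%N (isT : 1 < L.+2)%N.
case: (up_log 2 L.+2) => [|l] /= H; first by lra.
have h : l%:R * ln 2 <= ln (3 * ln B).
  rewrite -ln_exp2 ler_ln ?posrE ?exprn_gt0 ?mulr_gt0 //; apply: le_trans LB.
  by rewrite -natrX ler_nat ltnW.
rewrite lnM ?posrE // in h; have l3 : ln 3 <= 2 :> R by have := @ln_le_sub1 3; lra.
have l2 := ln2_ge; have l0 : 0 <= l%:R :> R by [].
(* From ln 2 >= 1/2 and ln 3 <= 2, l + 1 <= 5 + 2 ln ln B, and ln ln B >= 1. *)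
rewrite -natr1; nra.
Qed.

Lemma prime_sum_ln (N : R) (M : nat) : (2 < Num.truncn N)%N -> 0 <= N ->
  \sum_(Num.truncn N <= p < M | prime p) (p%:R ^- 2) <= 48 / (N * ln N) :> R.
Proof.
move=> N2 N0; have /andP[h1 h2] := truncn_itv N0.
move: (Num.truncn N) N2 h1 h2 => N' N2 h1 h2.
have [j [j0 jN Nj]] : exists j, [/\ (0 < j)%N, (2 ^ j < N')%N & (N' <= 2 ^ j.+1)%N].
  have /andP[] : (2 ^ (up_log 2 N').-1 < N' <= 2 ^ up_log 2 N')%N.
    by apply: up_log_bounds => //; lia.
  case: (up_log 2 N') => [|[|j]] /= u1 u2; [lia | lia | by exists j.+1].
apply: le_trans (sum_prime_inv_sqr R M j0 jN) _.
have N3 : 3 <= N by apply: le_trans h1; rewrite ler_nat.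
have lN : 0 < ln N by rewrite ln_gt0 //; lra.
have NN : 0 < N * ln N by rewrite mulr_gt0 //; lra.
have x0 : 0 < 2 ^+ j :> R by rewrite exprn_gt0.
have jR : 1 <= j%:R :> R by rewrite ler1n.
have le1 : N <= 4 * 2 ^+ j.
  apply: le_trans (ltW h2) _; rewrite -[4]/(4%:R) -natrX -natrM ler_nat.
  have p0 : (0 < 2 ^ j)%N by rewrite expn_gt0.
  by move: Nj p0; rewrite expnS; move: (2 ^ j)%N => b; lia.
have le2 : ln N <= 3 * j%:R.
  have : ln N <= ln (2 ^+ j.+2).
    by rewrite ler_ln ?posrE ?exprn_gt0 //; [rewrite !exprS; lra | lra].
  have l2 : ln 2 <= 1 :> R by have := @ln_le_sub1 2; lra.
  rewrite ln_exp2 -addn2 natrD; have := ln2_ge; nra.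
rewrite ler_pdivlMr // mulrAC ler_pdivrMr ?mulr_gt0 //; last by lra.
(* 48 is the 4 of the dyadic sum times the 4 of N <= 4 2^j times the 3 of ln N <= 3 j. *)
apply: (@le_trans _ _ (4 * (4 * 2 ^+ j * (3 * j%:R)))); last by rewrite le_eqVlt; apply/orP; left; apply/eqP; ring.
by rewrite ler_wpM2l // ler_pM // ?ltW // ; lra.
Qed.

End RealEstimates.

(** * The count of bad points *)

(** The first bound counts all points and serves for small N, the second is the sieve. For 2^L of
    the order of B, G / (L + 1) has order B (log B)^(r-1) and l has order log log B. *)
Lemma count_bad_points (R : realType) (n k : nat) (v : 'I_k.+1 -> 'I_n -> int)
  (cones : seq {set 'I_k.+1}) (F : seq {mpoly rat[k.+1]}) :
  complete_regular_fan v cones -> anticanonical_gg v cones -> codim_ge2 cones F ->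
  (0 < n)%N ->
  exists C p0 K : nat, forall (L : nat) (N B : R),
    (K * up_log 2 L.+1 <= L)%N -> 0 <= N -> B < 2 ^+ L.+1 ->
    forall s : seq 'rV[rat]_n, uniq s ->
    (forall t, t \in s -> bad_point v cones F N B t) ->
    let G : R := 2 ^+ L * L.+1%:R ^+ (k.+1 - n) in
    let l := up_log 2 L.+1 in
    (size s)%:R <= C%:R * (G / L.+1%:R) /\
    ((p0 < Num.truncn N)%N -> (size s)%:R <= C%:R *
      (G / L.+1%:R * \sum_(Num.truncn N <= p < 2 ^ (2 * l) | prime p) (p%:R ^- 2)
       + l.+1%:R * (G / L.+1%:R ^+ 2))).
Proof.
move=> fan gg codim n0; have [_ cov _ _] := fan.
have [K KP] := fan_sums fan gg R n0.
have /choice[Hf HfP] := fun i => closure_elimination i cov codim.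
pose H (i : nat) := if (insub i : option 'I_k.+1) is Some j then Hf j else 0.
have HE (i : 'I_k.+1) : H i = Hf i by rewrite /H valK.
have HH : off_axis H.
  move=> i ik; rewrite -[i]/(val (Ordinal ik)) HE.
  have [_ nz ind] := HfP (Ordinal ik); split=> // x y _ _ xy.
  by apply: ind => j ji; apply: xy.
have [C1 [p0 sieve]] := box_sieve R HH.
(* 4^(k+1) comes from [vol_side], the rest from the bound of [fan_sums] with 2^(L+1) written as 2
   times 2^L. *)
pose c0 := (4 ^ k.+1 * (size cones * (2 ^ n * 2)))%N.
exists (c0 + c0 * (2 * C1 + 2 * k.+1))%N, p0, K => L N B KL N0 BL s us bad G l.
have /choice[x xP] : forall t, exists x : 'I_k.+1 -> int, t \in s ->
    cox_lift v cones t x /\ exists p, [/\ prime p, N <= p%:R & reduction_in_Z cones F x p].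
  move=> t; have [ts|ts] := boolP (t \in s); last by exists (fun=> 0).
  by have [_ _ [x xt]] := bad t ts; exists x.
pose xs t : seq int := [seq x t i | i <- enum 'I_k.+1].
have xsE t (i : 'I_k.+1) : nth 0 (xs t) i = x t i.
  by rewrite (nth_map ord0) ?size_enum_ord // nth_ord_enum.
have sxs t : size (xs t) = k.+1 by rewrite size_map size_enum_ord.
have xs_inj : {in s &, injective xs}.
  move=> t t' ts ts' tt'; have [[_ tE _] _] := xP t ts; have [[_ tE' _] _] := xP t' ts'.
  apply/rowP => i; rewrite tE tE'; apply: eq_bigr => rho _.
  by rewrite -!xsE tt'.
pose Q (a : {ffun 'I_k.+1 -> 'I_L.+1}) := `[< height_le v L (nat_exps a) >].
pose T := [set a | Q a].
have lowT a : a \in T -> height_le v L (nat_exps a) by rewrite inE => /asboolP.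
have low_x t : t \in s -> height_le v L (fun rho => trunc_log 2 (absz (x t rho))).
  by move=> ts; have [_ Ht _] := bad t ts; have [xt _] := xP t ts; apply: low_lift Ht xt BL.
(* The lattice point 0 of the polytope gives sum_rho a_rho <= L, so each exponent is at most L. *)
have log_le t i : t \in s -> (trunc_log 2 (absz (x t i)) <= L)%N.
  move=> ts; have p0E rho : pairing v (fun=> 0) rho = 0.
    by rewrite /pairing big1 // => j _; rewrite mul0r.
  have := low_x t ts (fun=> 0); rewrite /in_antican_polytope.
  have pol rho : -1 <= pairing v (fun=> 0) rho by rewrite p0E.
  move=> /(_ pol); rewrite -lez_nat; apply: le_trans.
  rewrite (bigD1 i) //= p0E add0r mulr1 lerDl; apply: sumr_ge0 => rho _.
  by rewrite p0E add0r mulr1.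
have Qx t : t \in s -> Q (log_exps k.+1 L (xs t)).
  move=> ts; apply/asboolP; rewrite (_ : nat_exps _ = fun rho => trunc_log 2 (absz (x t rho))).
    exact: low_x.
  by apply: funext => i; rewrite /nat_exps ffunE xsE inordK // ltnS log_le.
have coord t : t \in s -> forall i : 'I_k.+1,
    nth 0 (xs t) i != 0 /\ (trunc_log 2 (absz (nth 0%R (xs t) i)) <= L)%N.
  by move=> ts i; rewrite xsE; have [[x0 _ _] _] := xP t ts; rewrite x0 log_le.
have [bd1 _] := KP L KL T lowT.
set W := \sum_(a in T) _ in bd1.
have L0 : 0 < L.+1%:R :> R by rewrite ltr0n.
have G0 : 0 <= G by rewrite mulr_ge0 ?exprn_ge0.
have bdE : (size cones)%:R * (2 ^+ n * 2 ^+ L.+1 * L.+1%:R ^+ (k.+1 - n)) =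
    (size cones * (2 ^ n * 2))%:R * G :> R.
  by rewrite /G !natrM natrX exprS; ring.
rewrite bdE in bd1.
have c0E : c0%:R = 4 ^+ k.+1 * (size cones * (2 ^ n * 2))%:R :> R by rewrite /c0 natrM natrX.
have W1 : 4 ^+ k.+1 * W <= c0%:R * (G / L.+1%:R).
  by rewrite c0E -mulrA ler_wpM2l ?exprn_ge0 // mulrA ler_pdivlMr.
have volE a : vol R (side a) k.+1 = 4 ^+ k.+1 * 2 ^+ (\sum_i a i) := vol_side R a.
have volW : \sum_(a in T) vol R (side a) k.+1 = 4 ^+ k.+1 * W.
  by rewrite /W mulr_sumr; apply: eq_bigr => a _; rewrite volE.
have GL0 : 0 <= G / L.+1%:R by rewrite divr_ge0 // ltW.
split.
  apply: (@le_trans _ _ (c0%:R * (G / L.+1%:R))); last by rewrite ler_wpM2r // ler_nat leq_addr.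
  apply: le_trans W1; rewrite -volW.
  have := size_le_boxes (P := predT) (Q := Q) us xs_inj.
  move=> /(_ (fun t ts => And4 (sxs t) isT (Qx t ts) (coord t ts))).
  rewrite -(ler_nat R) natr_sum => sz; apply: le_trans sz _.
  rewrite (eq_bigl (fun a => a \in T)) => [|a]; last by rewrite inE.
  by apply: ler_sum => a _; apply: count_box_le_vol.
move=> Np; pose P x := `[< exists p, [/\ prime p, (Num.truncn N <= p)%N & all_dvd H p x] >].
have Px t : t \in s -> P (xs t).
  move=> ts; have [_ [p [pp Np' red]]] := xP t ts; apply/asboolP; exists p; split=> //.
    by have /andP[h _] := truncn_itv N0; rewrite -(ler_nat R); apply: le_trans h Np'.
  apply/all_dvdP => i ik; rewrite -[i]/(val (Ordinal ik)) HE.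
  have [Hcl _ _] := HfP (Ordinal ik); have := red _ Hcl.
  by rewrite /seqeval (@meval_eq _ _ _ (x t)) // => j; apply: xsE.
have := size_le_boxes (P := P) (Q := Q) us xs_inj.
move=> /(_ (fun t ts => And4 (sxs t) (Px t ts) (Qx t ts) (coord t ts))).
rewrite -(ler_nat R) natr_sum (eq_bigl (fun a => a \in T)) => [sz|a]; last by rewrite inE.
apply: le_trans sz _.
set S := \sum_(_ <= p < _ | _) _.
have S0 : 0 <= S by apply: sumr_ge0 => p _; rewrite invr_ge0 exprn_ge0.
have Ll : (L < 2 ^ l)%N := up_logP L.+1 (isT : 1 < 2)%N.
(* M = 2^(2l) is at least (L + 1)^2. The box sides reach 2^(L+1), hence the numerator L + 2. *)
have M_le : L.+2%:R / (2 ^ (2 * l))%:R <= 2 / L.+1%:R :> R.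
  rewrite ler_pdivrMr ?ltr0n ?expn_gt0 // mulrAC ler_pdivlMr // -!natrM ler_nat.
  rewrite [(2 * l)%N]mul2n -addnn expnD; move: Ll; move: (2 ^ l)%N => b Lb.
  apply: (@leq_trans (b.+1 * b)); first by rewrite leq_mul.
  by rewrite mulSn mul2n -addnn leq_add2r leq_pmulr // (leq_ltn_trans _ Lb).
(* Boxes with a short side are not sieved: their full volume is charged to every pair (i, al) with
   a_i = al < 2l. *)
pose small (a : {ffun 'I_k.+1 -> 'I_L.+1}) : R :=
  \sum_(i < k.+1) \sum_(al < 2 * l) (a i == al :> nat)%:R * vol R (side a) k.+1.
have each a : (count P (box (side a) k.+1))%:R <=
    C1%:R * vol R (side a) k.+1 * (S + 2 / L.+1%:R) + small a.
  have V0 := vol_ge0 R (side a) k.+1.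
  have small0 : 0 <= small a by do 2 (apply: sumr_ge0 => ? _); rewrite mulr_ge0.
  have [big|] := boolP [forall i, 2 * l <= a i]%N.
    rewrite -[leLHS]addr0 lerD //.
    have := sieve L.+1 (2 ^ (2 * l))%N (Num.truncn N) (side a); rewrite expn_gt0 => /(_ isT Np) Hs.
    apply: le_trans (Hs _) _ => [i ik|].
      rewrite -[i]/(val (Ordinal ik)) sideE !leq_exp2l //.
      by rewrite (leqW (forallP big _)) ltnS -ltnS ltn_ord.
    by rewrite ler_wpM2l ?mulr_ge0 // lerD2l.
  move=> /forallPn[i]; rewrite -ltnNge => ai.
  apply: (@le_trans _ _ (small a)); last first.
    by rewrite lerDr !mulr_ge0 ?addr_ge0 ?divr_ge0 // ltW.
  apply: le_trans (count_box_le_vol R _ _ _) _.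
  rewrite /small (bigD1 i) //= (bigD1 (Ordinal ai)) //= eqxx mul1r -addrA lerDl.
  by rewrite addr_ge0 // sumr_ge0 // => ? _; rewrite ?sumr_ge0 // => *; rewrite mulr_ge0.
apply: le_trans (ler_sum _ (fun a _ => each a)) _.
rewrite big_split /= -mulr_suml -mulr_sumr volW.
have smallE : \sum_(a in T) small a <= (2 * k.+1)%:R * l%:R * (c0%:R * (G / L.+1%:R ^+ 2)).
  rewrite /small exchange_big /=.
  apply: (@le_trans _ _ (\sum_(i < k.+1) \sum_(al < 2 * l) c0%:R * (G / L.+1%:R ^+ 2))); last first.
    by rewrite !sumr_const !card_ord -mulrnA -[_ *+ (_ * _)]mulr_natl -natrM mulnAC.
  apply: ler_sum => i _; rewrite exchange_big /=; apply: ler_sum => al _.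
  pose T' := [set a in T | a i == al :> nat].
  have T'T a : a \in T' -> a \in T by rewrite inE => /andP[].
  have [_ bd2] := KP L KL T' (fun a aT' => lowT a (T'T a aT')).
  have {}bd2 : (\sum_(a in T') 2 ^+ (\sum_i a i)) * L.+1%:R ^+ 2 <=
      (size cones * (2 ^ n * 2))%:R * G.
    rewrite -bdE; apply: (bd2 i al) => [|a]; first exact/ltnW/ltn_ord.
    by rewrite inE => /andP[_ /eqP].
  rewrite (_ : \sum_(a in T) _ = 4 ^+ k.+1 * \sum_(a in T') 2 ^+ (\sum_i a i)).
    by rewrite c0E -mulrA ler_wpM2l ?exprn_ge0 // mulrA ler_pdivlMr ?exprn_gt0.
  rewrite mulr_sumr big_mkcond [RHS]big_mkcond; apply: eq_bigr => a _.
  rewrite [a \in T']inE; case: (a \in T) => //=.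
  by case: eqP => _; rewrite ?mul1r ?mul0r.
apply: le_trans (lerD _ smallE) _; first exact: lexx.
set q := G / _ in W1 GL0 *; set q2 := G / _.
have q2E : q / L.+1%:R = q2 by rewrite /q /q2 -mulrA -invfM.
have q20 : 0 <= q2 by rewrite -q2E divr_ge0 // ltW.
have C1W : C1%:R * (4 ^+ k.+1 * W) <= C1%:R * (c0%:R * q) by rewrite ler_wpM2l.
have SL : 0 <= S + 2 / L.+1%:R by rewrite addr_ge0 // divr_ge0 // ltW.
apply: le_trans (lerD (ler_wpM2r SL C1W) (lexx _)) _.
have -> : C1%:R * (c0%:R * q) * (S + 2 / L.+1%:R) =
    C1%:R * c0%:R * (q * S) + 2 * C1%:R * c0%:R * q2 by rewrite -q2E; ring.
rewrite [(c0 + _)%:R]natrD [(c0 * _)%:R]natrM.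
have qS : 0 <= q * S by rewrite mulr_ge0.
have c1 : 0 <= C1%:R :> R by []. have c2 : 0 <= c0%:R :> R by [].
have c3 : 0 <= l%:R :> R by []. have c4 : 0 <= k.+1%:R :> R by [].
clear q2E smallE. move: (q * S) qS q2 q20 (c0%:R : R) c2; rewrite -[l.+1%:R]natr1 !natrD !natrM.
move: (C1%:R : R) c1 (l%:R : R) c3 (k.+1%:R : R) c4.
move=> a a0 c cc0 d d0 X X0 Y Y0 b b0.
have t1 : 0 <= b * X by rewrite mulr_ge0.
have t2 : 0 <= b * Y by rewrite mulr_ge0.
have t3 : 0 <= a * (b * X) by rewrite mulr_ge0.
have t4 : 0 <= d * (b * X) by rewrite mulr_ge0.
have t5 : 0 <= d * (b * Y) by rewrite mulr_ge0.
have t6 : 0 <= c * (a * (b * Y)) by rewrite !mulr_ge0.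
have t8 : 0 <= a * (b * Y) by rewrite mulr_ge0.
have t7 : 0 <= c * (b * Y) by rewrite !mulr_ge0.
lra.
Qed.

Lemma ln_ln_ge1 (R : realType) (B : R) : expR (expR 1) <= B ->
  [/\ 1 <= B, 2 <= ln B & 1 <= ln (ln B)].
Proof.
move=> HB; have e2 : 2 <= expR 1 :> R by apply: le_trans (expR_ge1Dx _); lra.
have lB : expR 1 <= ln B.
  by rewrite -(expRK (expR 1)) ler_ln ?posrE ?expR_gt0 //; apply: lt_le_trans HB; apply: expR_gt0.
split; last by rewrite -[leLHS](@expRK R) ler_ln ?posrE ?expR_gt0 //; apply: lt_le_trans lB; apply: expR_gt0.
  by apply: le_trans HB; apply: le_trans (expR_ge1Dx _); lra.
exact: le_trans lB.
Qed.

(** Serves the case n = 0, where r = 0 and the second term of the bound, with (log B)^(-2), must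
    still dominate one point. *)
Lemma sqr_ln_le (R : realType) (B : R) : 0 < B -> 0 <= ln B -> ln B ^+ 2 <= 4 * B.
Proof.
move=> B0 l0; rewrite -[B in leRHS]lnK ?posrE //.
have : 1 + ln B / 2 <= expR (ln B / 2) := expR_ge1Dx _.
rewrite -[X in 4 * expR X](_ : ln B / 2 + ln B / 2 = ln B); last by lra.
rewrite expRD; move: (expR _) => y; move: (ln B) l0 => x x0 H; nra.
Qed.

Lemma absorb_constants (R : realFieldType) (A c u w x : R) :
  0 <= A -> 0 <= c -> 0 <= u -> 0 <= w ->
  x <= A * (c * u) \/ x <= A * (48 * u + 8 * w) ->
  x <= (A * (c + 48) + 1) * (u + w).
Proof.
move=> A0 c0 u0 w0 H.
have Au : 0 <= A * u by apply: mulr_ge0.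
have Aw : 0 <= A * w by apply: mulr_ge0.
have Acu : 0 <= A * c * u by rewrite !mulr_ge0.
have Acw : 0 <= A * c * w by rewrite !mulr_ge0.
by case: H => H; lra.
Qed.

Theorem theorem1p2 (R : realType) (n k : nat) (v : 'I_k -> 'I_n -> int)
  (cones : seq {set 'I_k}) (F : seq (mpoly.mpoly k rat)) :
  complete_regular_fan v cones ->
  projective_fan v cones ->
  anticanonical_gg v cones ->
  (forall f, f \in F -> cox_homogeneous v f) ->
  codim_ge2 cones F ->
  let r : int := (k - n)%:Z in
  exists C B0 : R, 0 < C /\
    forall N B : R, 1 < N -> B0 <= B ->
    forall s : seq 'rV[rat]_n, uniq s ->
      (forall t, t \in s -> bad_point v cones F N B t) ->
      (size s)%:R <= C * (B * ln B ^ (r - 1) / (N * ln N)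
                          + B * ln B ^ (r - 2) * ln (ln B)).
Proof.
(* For n = 0 there are no rays and the torus is a single point. *)
move=> fan _ gg _ codim; cbv zeta; have [n0|n_gt0] := posnP n.
  have k0 : k = 0%N.
    have [reg cov _ _] := fan; case: (k) v cones fan gg reg cov {F codim} => // k' v' c' _ _ reg cov.
    have [s s_in s0] := cov ord0; have [sn _] := reg s s_in.
    by move: s0; rewrite (cards0_eq (etrans sn n0)) inE.
  exists 4, (expR (expR 1)); split=> // N B N1 /ln_ln_ge1[B1 lB llB] s us _.
  have s1 : (size s <= 1)%N.
    case: s us => [|t [|t' s]] //= /andP[]; rewrite inE negb_or => /andP[/eqP tt' _] _.
    by case: tt'; apply/rowP => -[i i_lt]; exfalso; move: i_lt; rewrite n0.
  apply: (@le_trans _ _ 1); first by rewrite lern1.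
  have B_gt0 : 0 < B by lra.
  have sq : ln B ^+ 2 <= 4 * B by apply: sqr_ln_le; lra.
  have lN : 0 < ln N by rewrite ln_gt0.
  have p1 : 0 <= B * ln B ^ ((k - n)%:Z - 1) / (N * ln N).
    by rewrite divr_ge0 ?mulr_ge0 ?exprz_ge0 //; lra.
  have p2 : ln B ^ ((k - n)%:Z - 2) = (ln B ^+ 2)^-1 by rewrite k0 n0.
  rewrite p2 mulrDr -[leLHS]add0r lerD ?(mulr_ge0 _ p1) //.
  have x0 : 0 < ln B ^+ 2 by rewrite exprn_gt0 //; lra.
  apply: (@le_trans _ _ (4 * (B * (ln B ^+ 2)^-1))); first by rewrite mulrA ler_pdivlMr ?mul1r.
  by rewrite ler_wpM2l // ler_peMr // divr_ge0 // ltW.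
have nk := rank_pos fan gg n_gt0.
case: k v cones F fan gg codim nk => // k v cones F fan gg codim nk.
have [C0 [p0 [K HC]]] := count_bad_points R fan gg codim n_gt0.
have [L0 HL0] := up_log_small K.
have [d rE] : exists d, (k.+1 - n)%N = d.+1 by exists (k.+1 - n).-1; rewrite prednK // subn_gt0.
(* Bounds N log N when the integer part of N is at most p0 + 2. In [A], the factor 3^d comes from L
   + 1 <= 3 ln B with d = r - 1. *)
pose c1 : R := (p0 + 3)%:R ^+ 2.
have c1_0 : 0 <= c1 by rewrite exprn_ge0.
pose A : R := C0%:R * 3 ^+ d.
have A0 : 0 <= A by rewrite mulr_ge0 ?exprn_ge0.
exists (A * (c1 + 48) + 1), (2 ^+ L0 + expR (expR 1)); split.
  by rewrite ltr_wpDl // mulr_ge0 // addr_ge0.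
move=> N B N1 HB s us bad.
have two0 : 0 < 2 ^+ L0 :> R by rewrite exprn_gt0.
have [B1 lB llB] : [/\ 1 <= B, 2 <= ln B & 1 <= ln (ln B)].
  by apply: ln_ln_ge1; apply: le_trans HB; rewrite lerDr ltW.
have [L LB] := dyadic_floor B1.
have L0L : (L0 <= L)%N.
  have /andP[_ BL] := LB; rewrite -ltnS -(@ltn_exp2l 2) // -(ltr_nat R) !natrX.
  by apply: le_lt_trans BL; apply: le_trans HB; rewrite lerDl expR_ge0.
have B_gt0 : 0 < B := lt_le_trans ltr01 B1.
have lB1 : 1 <= ln B by apply: le_trans lB; rewrite ler1n.
have /andP[Ll Lu] := dyadic_ln lB1 B_gt0 LB.
have lB_gt0 : 0 < ln B := lt_le_trans ltr01 lB1.
have l_le := up_log_ln llB lB_gt0 Lu.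
have N_gt0 : 0 < N := lt_trans ltr01 N1.
have N0 := ltW N_gt0.
have /andP[LB1 LB2] := LB.
have [bd1 bd2] := HC L N B (HL0 L L0L) N0 LB2 s us bad.
set G := 2 ^+ L * _ in bd1 bd2.
have Lp : 0 < L.+1%:R :> R by rewrite ltr0n.
pose Y := B * ln B ^+ d.
have Y0 : 0 <= Y by rewrite mulr_ge0 ?exprn_ge0 ?ltW.
have GY : G / L.+1%:R <= 3 ^+ d * Y.
  rewrite /G rE exprSr mulrA mulfK ?gt_eqF // /Y mulrCA -exprMn.
  have l3 : 0 <= 3 * ln B by rewrite mulr_ge0 // ltW.
  by rewrite ler_pM ?exprn_ge0 // lerXn2r ?nnegrE.
have G0 : 0 <= G / L.+1%:R by rewrite !mulr_ge0 ?exprn_ge0 ?invr_ge0.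
have GY2 : G / L.+1%:R ^+ 2 <= 3 ^+ d * (Y / ln B).
  have -> : G / L.+1%:R ^+ 2 = G / L.+1%:R / L.+1%:R by rewrite expr2 invfM mulrA.
  by rewrite [leRHS]mulrA ler_pM ?invr_ge0 ?lef_pV2 ?posrE.
have E1 : B * ln B ^ ((k.+1 - n)%:Z - 1) = Y by rewrite rE -addn1 PoszD addrK.
have E2 : B * ln B ^ ((k.+1 - n)%:Z - 2) = Y / ln B.
  rewrite rE (_ : d.+1%:Z - 2 = d%:Z + -1); last by rewrite -addn1 PoszD -addrA.
  by rewrite expfzDr ?gt_eqF // exprN1 mulrA.
rewrite E1 E2.
have lN : 0 < ln N by rewrite ln_gt0.
have NN : 0 < N * ln N := mulr_gt0 N_gt0 lN.
set u := Y / (N * ln N); set w := Y / ln B * ln (ln B).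
have u0 : 0 <= u by apply: divr_ge0 => //; apply: ltW.
have llB0 : 0 <= ln (ln B) := le_trans ler01 llB.
have w0 : 0 <= w by apply: mulr_ge0 => //; apply: divr_ge0 => //; apply: ltW.
apply: absorb_constants => //.
have [Nsmall|Nbig] := leqP (Num.truncn N) (p0 + 2).
  have Nc : N * ln N <= c1.
    have /andP[_ N2] := truncn_itv N0.
    have N3 : N <= (p0 + 3)%:R by apply: le_trans (ltW N2) _; rewrite ler_nat addnS ltnS.
    have lNN : ln N <= (p0 + 3)%:R.
      apply: le_trans (ln_le_sub1 N_gt0) _; rewrite lerBlDr; apply: le_trans N3 _.
      by rewrite lerDl.
    by rewrite /c1 expr2 ler_pM // ltW.
  left; apply: le_trans bd1 _; apply: (@le_trans _ _ (A * Y)).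
    by rewrite /A -mulrA ler_wpM2l.
  by rewrite ler_wpM2l // /u mulrA ler_pdivlMr // mulrC ler_wpM2r.
have p0N : (p0 < Num.truncn N)%N := leq_ltn_trans (leq_addr 2 p0) Nbig.
right; apply: le_trans (bd2 p0N) _.
have PS := prime_sum_ln (2 ^ (2 * up_log 2 L.+1))%N (_ : (2 < Num.truncn N)%N) N0.
have {}PS := PS (leq_ltn_trans (leq_addl _ _) Nbig).
have S1 : G / L.+1%:R * \sum_(Num.truncn N <= p < 2 ^ (2 * up_log 2 L.+1) | prime p) (p%:R ^- 2)
   <= 3 ^+ d * (48 * u).
  rewrite /u (_ : 3 ^+ d * _ = 3 ^+ d * Y * (48 / (N * ln N))); last by ring.
  by rewrite ler_pM // sumr_ge0 // => p _; rewrite invr_ge0 exprn_ge0.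
have S2 : (up_log 2 L.+1).+1%:R * (G / L.+1%:R ^+ 2) <= 3 ^+ d * (8 * w).
  rewrite (_ : 3 ^+ d * (8 * w) = 8 * ln (ln B) * (3 ^+ d * (Y / ln B))); last by rewrite /w; ring.
  rewrite ler_pM // ?mulr_ge0 ?exprn_ge0 ?invr_ge0 ?exprn_ge0 //.
  (* l <= 7 ln ln B, and the extra 1 in l + 1 is at most ln ln B. *)
  have -> : 8 = 7 + 1 :> R by ring.
  by rewrite -natr1 mulrDl mul1r lerD.
by rewrite /A -[leRHS]mulrA ler_wpM2l // mulrDr lerD.
Qed.
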